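(* Let $k$ be a field. Assume that one can factor a polynomial in one variable over $k$ of degree at most $t$ using a number of field operations which is polynomial in $g(t)$, where $g$ is some function. Let $R=k[X_0,\ldots,X_{m-1}]$ and let $\mathcal{F}\subset R$ be a finite set. Assume that the ideal $I$ generated by $\mathcal{F}$ is radical and that the system $\mathcal{F}$ has at most $e$ solutions over $\overline{k}$ (that is, in $\overline{k}^m$). Set $d=\max(d_{\mathcal{F}},e)$. Then one can find all solutions of $I$ in $k$ (that is, all common zeros of $I$ in $k^m$) in a number of field operations which is polynomial in the cardinality of $\mathcal{F}$, $g(d)$ and $(m+d)^d$.
   Context: Degree means total degree. For $i\in\mathbf{Z}_{\ge0}$, $V_{\mathcal{F},i}$ is the smallest $k$-vector space such that (1) $\{f\in\mathcal{F}:\deg(f)\le i\}\subseteq V_{\mathcal{F},i}$; (2) if $g\in V_{\mathcal{F},i}$ and $h\in R$ with $\deg(hg)\le i$, then $hg\in V_{\mathcal{F},i}$. Set $V_{\mathcal{F},\infty}=I$. The last fall degree $d_{\mathcal{F}}$ is the minimal $d\in\mathbf{Z}_{\ge0}\sqcup\{\infty\}$ such that for all $f\in I$ one has $f\in V_{\mathcal{F},\max(d,\deg(f))}$ (it is always finite). *)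

(* Defs.v *)
From mathcomp Require Import all_boot all_order all_algebra.
From mathcomp Require Import mpoly.

Set Implicit Arguments.
Unset Strict Implicit.
Unset Printing Implicit Defensive.

Import GRing.Theory Num.Theory.
Local Open Scope ring_scope.

(* Algorithms are algebraic computation trees: a node performs one field
   operation or one test for zero, and the two subtrees of a test are the only
   way in which the computation can depend on the field elements.  The trees are
   first-order syntax: under classical axioms a shallow or parametric embedding
   could inspect the values for free.  Constants of k are free. *)

Inductive fop := Add | Sub | Mul | Div.

Inductive addr (k X : Type) := Inp of X | Cst of k | Reg of nat.

Arguments Inp {k X} _.
Arguments Cst {k X} _.
Arguments Reg {k X} _.

(* The result of the j-th [Op] on a path is [Reg j], counting from 0. *)
Inductive ctree (k X : Type) :=
| Out of seq (seq (addr k X))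
| Op of fop & addr k X & addr k X & ctree k X
| IfZero of addr k X & ctree k X & ctree k X.

Section Run.
Variables (k : fieldType) (X : Type) (inp : X -> k).

Definition fetch (regs : seq k) (a : addr k X) : k :=
  match a with
  | Inp x => inp x
  | Cst c => c
  | Reg j => nth 0 regs j
  end.

(* Division is total, with x / 0 = 0; it saves at most one test. *)
Definition apply_fop (o : fop) (x y : k) : k :=
  match o with
  | Add => x + y
  | Sub => x - y
  | Mul => x * y
  | Div => x / y
  end.

Fixpoint run_from (regs : seq k) (t : ctree k X) : seq (seq k) * nat :=
  match t with
  | Out y => (map (map (fetch regs)) y, 0%N)
  | Op o a b t' =>
      let r := run_from
        (rcons regs (apply_fop o (fetch regs a) (fetch regs b))) t' in
      (r.1, r.2.+1)
  | IfZero a t0 t1 =>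
      let r := if fetch regs a == 0 then run_from regs t0
               else run_from regs t1 in
      (r.1, r.2.+1)
  end.

Definition output (t : ctree k X) : seq (seq k) := (run_from [::] t).1.

(* Number of arithmetic operations and tests performed on this input. *)
Definition cost (t : ctree k X) : nat := (run_from [::] t).2.

End Run.

(* Complete factorization up to a constant; a factor is output as the list of
   its coefficients, constant term first. *)
Definition is_factorization (k : fieldType) (f : {poly k})
    (out : seq (seq k)) : Prop :=
  (forall p, p \in out -> irreducible_poly (Poly p)) /\
  exists c : k, f = c *: \prod_(p <- out) Poly p.

Definition coefs (k : fieldType) (t : nat) (f : {poly k}) : 'I_t.+1 -> k :=
  fun i => f`_i.

Definition can_factor_within (R : numDomainType) (k : fieldType)
    (bound : nat -> R) : Prop :=
  exists factorizer : forall t : nat, ctree k 'I_t.+1,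
  forall (t : nat) (f : {poly k}), f != 0 -> (size f <= t.+1)%N ->
    is_factorization f (output (coefs f) (factorizer t)) /\
    (cost (coefs f) (factorizer t))%:R <= bound t.

Section LastFallDegree.
Variables (k : fieldType) (m : nat) (F : seq {mpoly k[m]}).

Definition in_ideal (f : {mpoly k[m]}) : Prop :=
  exists h : {mpoly k[m]} -> {mpoly k[m]}, f = \sum_(p <- F) h p * p.

Definition radical_ideal : Prop :=
  forall (f : {mpoly k[m]}) (n : nat), in_ideal (f ^+ n) -> in_ideal f.

(* [msize f] is deg f + 1, and 0 for f = 0. *)
Definition deg_le (f : {mpoly k[m]}) (i : nat) : Prop := (msize f <= i.+1)%N.

(* Total degree; the value 0 at f = 0 is harmless below, since 0 belongs to
   every V_{F,i}. *)
Definition tdeg (f : {mpoly k[m]}) : nat := (msize f).-1.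

Inductive fall_space (i : nat) : {mpoly k[m]} -> Prop :=
| fall_gen f : f \in F -> deg_le f i -> fall_space i f
| fall_mul g h : fall_space i g -> deg_le (h * g) i -> fall_space i (h * g)
| fall_zero : fall_space i 0
| fall_add f g : fall_space i f -> fall_space i g -> fall_space i (f + g)
| fall_scale (c : k) f : fall_space i f -> fall_space i (c *: f).

(* Indices in N with infinity adjoined, [None] being infinity. *)
Definition fall_space_ext (i : option nat) (f : {mpoly k[m]}) : Prop :=
  if i is Some j then fall_space j f else in_ideal f.

Definition max_ext (i : option nat) (j : nat) : option nat :=
  omap (fun i' => maxn i' j) i.

Definition le_ext (i j : option nat) : bool :=
  match i, j with
  | _, None => true
  | None, Some _ => false
  | Some i', Some j' => (i' <= j')%N
  end.

Definition fall_bound (d : option nat) : Prop :=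
  forall f, in_ideal f -> fall_space_ext (max_ext d (tdeg f)) f.

Definition is_last_fall_degree (d : option nat) : Prop :=
  fall_bound d /\ forall d', fall_bound d' -> le_ext d d'.

End LastFallDegree.

Definition is_algebraic_closure (k : fieldType) (kbar : closedFieldType)
    (iota : {rmorphism k -> kbar}) : Prop :=
  forall x : kbar, algebraicOver iota x.

Definition at_most_solutions (k : fieldType) (kbar : closedFieldType)
    (iota : {rmorphism k -> kbar}) (m : nat) (F : seq {mpoly k[m]})
    (e : nat) : Prop :=
  forall s : seq (m.-tuple kbar), uniq s ->
    (forall x, x \in s ->
       forall f, f \in F -> (map_mpoly iota f).@[tnth x] = 0) ->
    (size s <= e)%N.

Definition is_common_zero (k : fieldType) (m : nat) (F : seq {mpoly k[m]})
    (a : m.-tuple k) : Prop :=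
  forall f, in_ideal F f -> f.@[tnth a] = 0.

(* Input (j, u) of a system is the coefficient at the monomial u of its j-th
   polynomial. *)
Definition system_coefs (k : fieldType) (m : nat) (F : seq {mpoly k[m]}) :
    nat * 'X_{1..m} -> k :=
  fun x => (nth 0 F x.1)@_x.2.

Definition is_solution_list (k : fieldType) (m : nat) (F : seq {mpoly k[m]})
    (out : seq (seq k)) : Prop :=
  forall s : seq k,
    s \in out <-> exists2 a : m.-tuple k, s = a & is_common_zero F a.

(* The tree may depend on the number of variables m, on the list of the total
   degrees of the given polynomials (hence on their number) and on d, but on no
   coefficient: supports would already determine the system over F_2. *)
Definition system_solver (k : fieldType) : Type :=
  forall (m : nat) (degs : seq nat) (d : nat), ctree k (nat * 'X_{1..m}).

(* Main.v *)
Require Import Defs.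
From mathcomp Require Import all_boot all_order all_algebra.
From mathcomp Require Import mpoly.
From HB Require Import structures.
From mathcomp Require Import pgroup abelian finfield.
From mathcomp Require Import boolp classical_sets ring zify.

Set Implicit Arguments.
Unset Strict Implicit.
Unset Printing Implicit Defensive.

Import GRing.Theory Num.Theory.
Local Open Scope ring_scope.

(* A computation tree that extracts a root of X^2 - s^2 from s^2 would express s,
   for all but finitely many s, as a rational function of s^2; so only a finite
   field k can satisfy the factorization hypothesis.  Being perfect, k has the
   property that a linear dependence over the algebraic closure between the
   vectors of values of polynomials over k on the (Galois stable) zero set
   descends to k; as I is radical, the Nullstellensatz turns it into a
   dependence modulo I.  Hence any e + 1 polynomials are dependent modulo I,
   every polynomial is congruent modulo I to one of degree < d, and I contains
   a nonzero univariate polynomial of degree <= e in each variable.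

   The algorithm computes V_{F,d}, which is the degree <= d part of I, by linear
   algebra on the monomials of degree <= d, then eliminates and factors to get
   at most d candidate values for each coordinate, and builds the solutions one
   coordinate at a time.  A partial tuple a is kept when 1 does not lie in the
   span of V_{F,d} and of the (a_l - X_l) X^nu with deg nu < d: this span is the
   degree <= d part of I + (X_l - a_l)_l, so each kept tuple extends to a zero
   over the closure and at most e tuples are kept at every stage. *)

(** The number of zeros over the closure bounds the dimension of R/I only if I stays radical over
    the closure. Over an imperfect field this fails: X^p - a, with a not a p-th power, generates a
    radical ideal with one zero and a quotient of dimension p. This is why the finiteness of k has
    to be extracted from the factorization hypothesis before anything else. The bound on the cost
    allows no factor d^m, so the product of the candidate lists cannot be enumerated: partial tuples
    have to be pruned after every coordinate, by a test that stays in degree d. Such a test exists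
    because reduction modulo I reaches degree < d, which leaves room for one linear factor. The
    algorithm appears twice: as functions on polynomials, for which correctness is proved, and as
    programs emitting a tree, which are shown to simulate these functions at a bounded cost. *)

(** * Finite fields and the polynomial X^q - X *)

Lemma pchar_nat_card_finField (F : finFieldType) : [pchar F].-nat #|F|.
Proof.
have [p p_pr pF] := finPcharP F.
have := abelem_pgroup (fin_ring_pchar_abelem pF); rewrite /pgroup cardsT.
by rewrite (eq_pnat _ (pcharf_eq pF)).
Qed.

(** The finite structure is packed locally from the list, and only the consequences leave the proof.
    The factorization of X^q - X is what identifies k inside an extension as the fixed points of x
    -> x^q. *)
Lemma finite_field_Frobenius (k : fieldType) (s : seq k) :
  (forall x, x \in s) ->
  exists q : nat, [/\ (1 < q)%N, [pchar k].-nat q &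
    'X^q - 'X = \prod_(x <- undup s) ('X - x%:P) :> {poly k}].
Proof.
move=> all_s; set t := undup s.
have t_uniq : uniq t := undup_uniq s.
have all_t x : x \in t by rewrite mem_undup.
have pickleK : pcancel (index^~ t) (fun n => nth None (map some t) n).
  by move=> x; rewrite (nth_map x) ?nth_index ?index_mem.
pose C := HB.pack_for countType k (PCanIsCountable pickleK).
have enumP : Finite.axiom (t : seq C).
  by move=> x; rewrite count_uniq_mem ?all_t.
pose F := HB.pack_for finFieldType k (Countable.class C) (isFinite.Build C enumP).
exists #|F|; split.
- exact: finNzRing_gt1.
- exact: (pchar_nat_card_finField F).
- rewrite (finField_genPoly F) -big_enum /=.
  apply: perm_big; apply: uniq_perm => //; first exact: enum_uniq.
  by move=> x; rewrite all_t; apply: (@mem_enum F predT x).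
Qed.

(** * Factorization trees force a finite field *)

(** Without an enumeration, any repetition-free list inside [Pr] could be lengthened, eventually
    beyond n. Used for the elements of k and for the zeros over the closure. *)
Lemma bounded_uniq_enum (T : eqType) (Pr : T -> Prop) (n : nat) :
  (forall s : seq T, uniq s -> (forall x, x \in s -> Pr x) -> (size s <= n)%N) ->
  exists s : seq T, [/\ uniq s, (size s <= n)%N & forall x, x \in s <-> Pr x].
Proof.
move=> bnd; apply: contrapT => no_enum.
suff [s [s_uniq sP s_size]] : exists s : seq T,
    [/\ uniq s, forall x, x \in s -> Pr x & size s = n.+1].
  by have := bnd s s_uniq sP; rewrite s_size ltnn.
elim: (n.+1) => [|i [s [s_uniq sP s_size]]]; first by exists [::].
have [x [x_notin Px]] : exists x, x \notin s /\ Pr x.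
  apply: contrapT => no_x; apply: no_enum; exists s; split=> [//||x].
    exact: bnd.
  split=> [/sP//|Px]; apply: contrapT => /negP x_notin; apply: no_x.
  by exists x.
exists (x :: s); rewrite /= x_notin s_size; split=> // y.
by rewrite inE => /predU1P[->|/sP].
Qed.

Section Generic.
Variable k : fieldType.
Implicit Types (r : k -> k) (Pr : k -> Prop).

(** Over a finite field this is vacuous, since E may vanish on all of k. That is harmless:
    finiteness of k is what is to be proved, and no case distinction is needed on the way. *)
Definition generically Pr : Prop :=
  exists2 E : {poly k}, E != 0 & forall y, E.[y] != 0 -> Pr y.

Definition generically_rational r : Prop :=
  exists n d : {poly k}, d != 0 /\ generically (fun y => r y * d.[y] = n.[y]).

Lemma generically_and Pr Pr' :
  generically Pr -> generically Pr' -> generically (fun y => Pr y /\ Pr' y).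
Proof.
move=> [E E0 EP] [E' E'0 E'P]; exists (E * E'); first by rewrite mulf_neq0.
by move=> y; rewrite hornerM mulf_eq0 negb_or => /andP[/EP ? /E'P].
Qed.

Lemma generically_sub Pr Pr' :
  (forall y, Pr y -> Pr' y) -> generically Pr -> generically Pr'.
Proof. by move=> sub [E E0 EP]; exists E => // y /EP /sub. Qed.

Lemma generically_all Pr : (forall y, Pr y) -> generically Pr.
Proof. by move=> all; exists 1; rewrite ?oner_neq0. Qed.

Lemma generically_neq0 (d : {poly k}) : d != 0 -> generically (fun y => d.[y] != 0).
Proof. by exists d. Qed.

Lemma generically_rational_poly (p : {poly k}) : generically_rational (horner p).
Proof.
exists p, 1; split; rewrite ?oner_neq0 //; apply: generically_all => y.
by rewrite hornerE mulr1.
Qed.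

Lemma generically_rational_cst (c : k) : generically_rational (fun=> c).
Proof.
have [n [d [d0 [E E0 EP]]]] := generically_rational_poly c%:P.
by exists n, d; split=> //; exists E => // y /EP; rewrite hornerC.
Qed.

(** The numerator is the zero polynomial or has finitely many roots. Every test in a tree therefore
    has a generic outcome. *)
Lemma generically_zero_or_nonzero r : generically_rational r ->
  generically (fun y => r y = 0) \/ generically (fun y => r y != 0).
Proof.
move=> [n [d [d0 rE]]]; have [n0|n0] := eqVneq n 0; [left|right].
- apply: generically_sub (generically_and rE (generically_neq0 d0)) => y [].
  by move=> /eqP; rewrite n0 horner0 mulf_eq0 => /orP[/eqP//|->].
- apply: generically_sub (generically_and rE (generically_neq0 n0)) => y [<-].
  by rewrite mulf_eq0 negb_or => /andP[].
Qed.

Lemma generically_rational_op (o : fop) r r' :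
  generically_rational r -> generically_rational r' ->
  generically_rational (fun y => apply_fop o (r y) (r' y)).
Proof.
move=> rat_r rat_r'; have := generically_zero_or_nonzero rat_r'.
case: rat_r => n [d [d0 rE]]; case: rat_r' => n' [d' [d'0 r'E]] zero_or.
have dd'0 : d * d' != 0 by rewrite mulf_neq0.
have rr'E := generically_and rE r'E.
case: o; [ exists (n * d' + n' * d), (d * d')
         | exists (n * d' - n' * d), (d * d')
         | exists (n * n'), (d * d') | ].
- split=> //; apply: generically_sub rr'E => y [/= E1 E2].
  by rewrite /= !(hornerM, hornerD, hornerN) -E1 -E2; ring.
- split=> //; apply: generically_sub rr'E => y [/= E1 E2].
  by rewrite /= !(hornerM, hornerD, hornerN) -E1 -E2; ring.
- split=> //; apply: generically_sub rr'E => y [/= E1 E2].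
  by rewrite /= !(hornerM, hornerD, hornerN) -E1 -E2; ring.
(* By the convention x / 0 = 0, a quotient by a generically zero function is generically 0. *)
- case: zero_or => r'0.
    exists 0, 1; split; rewrite ?oner_neq0 //.
    by apply: generically_sub r'0 => y /= ->; rewrite invr0 mulr0 !hornerE.
  (* The numerator can be zero while the function is generically nonzero only if generic statements
     are vacuous; then any fraction will do. *)
  have n'0 : n' != 0 \/ generically (fun=> False).
    have [n'0|] := eqVneq n' 0; [right|by left].
    apply: generically_sub (generically_and r'0 (generically_and r'E (generically_neq0 d'0))).
    move=> y [r'y [/eqP]]; rewrite n'0 horner0 mulf_eq0 (negbTE r'y) /=.
    by move=> ->.
  case: n'0 => [n'0|[E E0 EP]]; last first.
    by exists 0, 1; split; rewrite ?oner_neq0 //; exists E => // y /EP.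
  exists (n * d'), (d * n'); split; first by rewrite mulf_neq0.
  apply: generically_sub (generically_and rr'E r'0) => y [[/= E1 E2] r'y].
  by rewrite /= !(hornerM, hornerD, hornerN) -E1 -E2; field.
Qed.

Section Run.
Variables (X : Type) (inp : X -> {poly k}).

Definition zfun : k -> k := fun=> 0.

Lemma nth_map_eval (regs : seq (k -> k)) (y : k) (j : nat) :
  nth 0 (map (fun r => r y) regs) j = nth zfun regs j y.
Proof.
have [lt_j|le_j] := ltnP j (size regs); first by rewrite (nth_map zfun).
by rewrite !nth_default ?size_map.
Qed.

Definition fetch_fun (regs : seq (k -> k)) (a : addr k X) : k -> k :=
  match a with Inp x => horner (inp x) | Cst c => fun=> c | Reg j => nth zfun regs j end.

Lemma fetch_funE regs a y :
  fetch (fun x => (inp x).[y]) (map (fun r => r y) regs) a = fetch_fun regs a y.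
Proof. by case: a => //= j; rewrite nth_map_eval. Qed.

Lemma fetch_fun_rational regs a :
  (forall j, generically_rational (nth zfun regs j)) ->
  generically_rational (fetch_fun regs a).
Proof.
move=> rat_regs; case: a => [x|c|j] //=.
- exact: generically_rational_poly.
- exact: generically_rational_cst.
Qed.

(** Since each test has a generic outcome, all arguments y outside the roots of one polynomial
    follow the same path, along which every register is a fixed rational function of y. *)
Lemma generic_run (t : ctree k X) (regs : seq (k -> k)) :
  (forall j, generically_rational (nth zfun regs j)) ->
  exists2 out : seq (seq (k -> k)),
    forall i j, generically_rational (nth zfun (nth [::] out i) j) &
    generically (fun y =>
      (run_from (fun x => (inp x).[y]) (map (fun r => r y) regs) t).1
      = map (map (fun r => r y)) out).
Proof.
elim: t regs => [ys|o a b t IH|a t0 IH0 t1 IH1] regs rat_regs /=.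
- exists (map (map (fetch_fun regs)) ys); last first.
    apply: generically_all => y; rewrite -map_comp; apply: eq_map => s /=.
    by rewrite -map_comp; apply: eq_map => c /=; rewrite fetch_funE.
  move=> i j; have [lt_i|le_i] := ltnP i (size ys); last first.
    by rewrite [nth [::] _ _]nth_default ?size_map // nth_nil; apply: generically_rational_cst.
  rewrite (nth_map [::]) //; set s := nth [::] ys i.
  have [lt_j|le_j] := ltnP j (size s); last first.
    by rewrite nth_default ?size_map //; apply: generically_rational_cst.
  by rewrite (nth_map (Cst 0)) //; apply: fetch_fun_rational.
- pose r y := apply_fop o (fetch_fun regs a y) (fetch_fun regs b y).
  have [|out rat_out outE] := IH (rcons regs r).
    move=> j; rewrite nth_rcons; case: ifP => // _; case: ifP => // _.
      by apply: generically_rational_op; apply: fetch_fun_rational.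
    exact: generically_rational_cst.
  exists out => //; apply: generically_sub outE => y <-.
  by rewrite map_rcons !fetch_funE.
- have [zero|nonzero] := generically_zero_or_nonzero (fetch_fun_rational a rat_regs).
  + have [out rat_out outE] := IH0 regs rat_regs; exists out => //.
    apply: generically_sub (generically_and zero outE) => y [z0 <-].
    by rewrite fetch_funE z0 eqxx.
  + have [out rat_out outE] := IH1 regs rat_regs; exists out => //.
    apply: generically_sub (generically_and nonzero outE) => y [z0 <-].
    by rewrite fetch_funE (negbTE z0).
Qed.
End Run.

Lemma comp_poly_sqr_neq0 (p : {poly k}) : p != 0 -> p \Po 'X^2 != 0.
Proof.
apply: contra_neq => p0; apply/polyP => i.
have := congr1 (fun q : {poly k} => q`_(i * 2)) p0.
by rewrite /= coef_comp_poly_Xn // dvdn_mull // mulnK // !coef0.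
Qed.

Lemma generically_comp_sqr Pr : generically Pr -> generically (fun s => Pr (s ^+ 2)).
Proof.
move=> [E E0 EP]; exists (E \Po 'X^2).
  exact: comp_poly_sqr_neq0.
by move=> y; rewrite horner_comp hornerXn => /EP.
Qed.

(** The two summands cannot cancel: the first has even degree or is zero, the second has odd
    degree. *)
Lemma even_odd_poly_neq0 (a b : {poly k}) :
  b != 0 -> a \Po 'X^2 + 'X * (b \Po 'X^2) != 0.
Proof.
move=> b0; have cb0 := comp_poly_sqr_neq0 b0.
have odd_size (p : {poly k}) : p \Po 'X^2 != 0 -> odd (size (p \Po 'X^2)).
  rewrite -size_poly_gt0 => /prednK <-.
  by rewrite size_comp_poly size_polyXn /= oddM andbF.
have [->|a0] := eqVneq (a \Po 'X^2) 0.
  by rewrite add0r mulf_neq0 // polyX_eq0.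
apply/negP; rewrite addr_eq0 => /eqP/(congr1 (fun p : {poly k} => odd (size p))).
by rewrite size_polyN mulrC size_mulX //= !odd_size.
Qed.

(** Clearing denominators in r0(s^2) + r1(s^2) s = 0 gives a root of an even polynomial plus an odd
    one, which is not the zero polynomial when the numerator of r1 is nonzero. When that numerator
    is zero, r1(s^2) vanishes generically and nothing is claimed. *)
Lemma generic_no_sqrt (r0 r1 : k -> k) :
  generically_rational r0 -> generically_rational r1 ->
  exists2 H : {poly k}, H != 0 &
    forall s, H.[s] != 0 -> r1 (s ^+ 2) != 0 -> r0 (s ^+ 2) + r1 (s ^+ 2) * s != 0.
Proof.
move=> [n0 [d0 [d00 r0E]]] [n1 [d1 [d10 r1E]]].
have [n1_eq0|n10] := eqVneq n1 0.
  have [H H0 HP] : generically (fun s => r1 (s ^+ 2) = 0).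
    apply: (generically_comp_sqr (Pr := fun y => r1 y = 0)).
    apply: generically_sub (generically_and r1E (generically_neq0 d10)) => y [].
    by move=> /eqP; rewrite n1_eq0 horner0 mulf_eq0 => /orP[/eqP//|->].
  by exists H => // s /HP ->; rewrite eqxx.
pose G := (n0 * d1) \Po 'X^2 + 'X * ((n1 * d0) \Po 'X^2).
have G0 : G != 0 by apply: even_odd_poly_neq0; rewrite mulf_neq0.
have [H H0 HP] := generically_and (generically_neq0 G0)
  (generically_comp_sqr (generically_and r0E r1E)).
exists H => // s /HP[Gs [/= E0 E1]] _; apply: contra_neq Gs => r01.
rewrite /G !(hornerM, hornerD, hornerX, horner_comp, hornerXn) -E0 -E1.
have -> : r0 (s ^+ 2) = - (r1 (s ^+ 2) * s) by apply/eqP; rewrite -addr_eq0 r01.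
ring.
Qed.

(** An irreducible polynomial with a root is linear. The list p may still end in zeros, so the
    conclusion speaks of entries and not of the length of p. *)
Lemma irreducible_root_coef (p : seq k) (x : k) :
  irreducible_poly (Poly p) -> root (Poly p) x ->
  nth 0 p 1 != 0 /\ nth 0 p 0 + nth 0 p 1 * x = 0.
Proof.
move=> [_ irr] px; have : 'X - x%:P %= Poly p.
  by apply: irr; rewrite ?size_XsubC // dvdp_XsubCl.
move=> /eqp_size; rewrite size_XsubC => /esym size_p.
have p1 : nth 0 p 1 != 0.
  have -> : nth 0 p 1 = lead_coef (Poly p) by rewrite lead_coefE size_p coef_Poly.
  by rewrite lead_coef_eq0 -size_poly_eq0 size_p.
split=> //; move: px.
rewrite rootE => /eqP; rewrite horner_coef size_p !big_ord_recl big_ord0 /= !coef_Poly.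
by rewrite expr0 mulr1 expr1 addr0.
Qed.

Lemma factorizable_field_finite (R : numDomainType) (bound : nat -> R) :
  can_factor_within k bound -> exists s : seq k, forall x, x \in s.
Proof.
move=> [factorizer fact].
(* The coefficients -y, 0, 1 of X^2 - y as polynomials in y; they are evaluated at y = x^2. *)
pose inp (i : 'I_3) : {poly k} := if i == 0 :> nat then - 'X else if i == 2 :> nat then 1 else 0.
have [|out rat_out /generically_comp_sqr outE] := @generic_run 'I_3 inp (factorizer 2) [::].
  by move=> j; rewrite nth_nil; apply: generically_rational_cst.
have no_root i : exists2 H : {poly k}, H != 0 & forall s, H.[s] != 0 ->
    nth zfun (nth [::] out i) 1 (s ^+ 2) != 0 ->
    nth zfun (nth [::] out i) 0 (s ^+ 2) + nth zfun (nth [::] out i) 1 (s ^+ 2) * s != 0.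
  by apply: generic_no_sqrt; apply: rat_out.
(* The number of output factors is constant on the generic path, so the product of finitely many
   exceptional polynomials serves for all of them. *)
have [H H0 HP] : exists2 H : {poly k}, H != 0 & forall s, H.[s] != 0 -> 
    forall i, (i < size out)%N ->
    nth zfun (nth [::] out i) 1 (s ^+ 2) != 0 ->
    nth zfun (nth [::] out i) 0 (s ^+ 2) + nth zfun (nth [::] out i) 1 (s ^+ 2) * s != 0.
  elim: (size out) => [|n [H H0 HP]]; first by exists 1; rewrite ?oner_neq0.
  have [H' H'0 H'P] := no_root n; exists (H * H'); first by rewrite mulf_neq0.
  move=> s; rewrite hornerM mulf_eq0 negb_or => /andP[/HP Hs /H'P H's] i.
  by rewrite ltnS leq_eqVlt => /orP[/eqP->|/Hs].
case: outE => E E0 EP.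
(* It is enough that E * H vanishes at every x in k. Otherwise the factor of X^2 - x^2 with root x
   is linear, and its two coefficients are rational functions of x^2, against the choice of H. *)
suff [s [_ _ sP]] : exists s : seq k, [/\ uniq s, (size s <= size (E * H)%R)%N &
    forall x, x \in s <-> True] by exists s => x; apply/sP.
apply: bounded_uniq_enum => s s_uniq _.
apply/ltnW/max_poly_roots => //; first by rewrite mulf_neq0.
apply/allP => x _; rewrite rootE hornerM; apply: contraT; rewrite mulf_eq0 negb_or.
move=> /andP[/EP outx /HP{}HP].
pose f : {poly k} := 'X^2 - (x ^+ 2)%:P.
have size_f : size f = 3%N by rewrite size_XnsubC.
have f0 : f != 0 by rewrite -size_poly_eq0 size_f.
have [[irr [c fE]] _] := fact 2 f f0 (eq_leq size_f).
have coefsE : coefs f = (fun i => (inp i).[x ^+ 2]).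
  apply/funext => i; rewrite /coefs /inp coefB coefXn coefC.
  by case: i => [[|[|[|]]] ?] /=; rewrite ?(hornerE, sub0r, subr0, oppr0).
rewrite coefsE /output outx in irr fE.
have : root f x by rewrite rootE /f !hornerE subrr.
rewrite fE rootZ; last by apply: contra_neq f0 => c0; rewrite fE c0 scale0r.
rewrite rootE horner_prod prodf_seq_eq0 => /hasP[p p_in /= px].
have := irreducible_root_coef (irr p p_in) px.
case/mapP: p_in => q /(nthP [::])[i lt_i <-] ->.
by rewrite !nth_map_eval => -[p1 /eqP p0]; have := HP i lt_i p1; rewrite p0.
Qed.

End Generic.

(** * The Nullstellensatz *)

Definition is_ideal (A : comNzRingType) (J : A -> Prop) : Prop :=
  [/\ J 0, forall x y, J x -> J y -> J (x + y) & forall a x, J x -> J (a * x)].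

Definition is_prime (A : comNzRingType) (P : A -> Prop) : Prop :=
  [/\ is_ideal P, ~ P 1 & forall x y, P (x * y) -> P x \/ P y].

Section Ideals.
Variables (A : comNzRingType) (J : A -> Prop).
Hypothesis idJ : is_ideal J.

Lemma ideal0 : J 0. Proof. by case: idJ. Qed.
Lemma idealD x y : J x -> J y -> J (x + y). Proof. by case: idJ => _ + _; apply. Qed.
Lemma idealMl a x : J x -> J (a * x). Proof. by case: idJ => _ _; apply. Qed.
Lemma idealN x : J x -> J (- x). Proof. by rewrite -mulN1r; apply: idealMl. Qed.
Lemma idealB x y : J x -> J y -> J (x - y).
Proof. by move=> Jx Jy; apply: idealD => //; apply: idealN. Qed.
Lemma ideal_sum (I : Type) (r : seq I) (Q : pred I) (F : I -> A) :
  (forall i, Q i -> J (F i)) -> J (\sum_(i <- r | Q i) F i).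
Proof. by move=> JF; elim/big_rec: _ => [|i x Qi Jx]; [apply: ideal0|apply: idealD; auto]. Qed.
End Ideals.

Lemma prime_exp (A : comNzRingType) (P : A -> Prop) : is_prime P ->
  forall x n, P (x ^+ n) -> P x.
Proof.
case=> idP P1 PM x; elim=> [|n IH]; first by rewrite expr0.
by rewrite exprS => /PM[].
Qed.

(* A prime containing J and avoiding the powers of u: an ideal maximal among
   those avoiding the powers of u. *)
Lemma prime_avoiding_powers (A : comNzRingType) (J : A -> Prop) (u : A) :
  is_ideal J -> (forall n, ~ J (u ^+ n)) ->
  exists P : A -> Prop, [/\ is_prime P, forall x, J x -> P x & ~ P u].
Proof.
move=> idJ avJ.
pose good (B : set A) := [/\ forall x, J x -> B x, is_ideal B & forall n, ~ B (u ^+ n)].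
(* The union of the empty chain is empty, whence the alternative [B = set0]; a maximal set is not
   empty, since J is larger than the empty set. *)
have [F FP Ftot|M [M0 Mmax]] := @Zorn_bigcup A (fun B => B = set0 \/ good B).
  have [[B0 FB0 [JB0 _ _]]|nogood] := pselect (exists2 B, F B & good B); last first.
    left; apply/seteqP; split => // x [B FB Bx]; case: (FP B FB) => [B0|gB].
      by rewrite B0 in Bx.
    by case: nogood; exists B.
  have Fgood B x : F B -> B x -> good B.
    by move=> FB Bx; case: (FP B FB) => // B0'; rewrite B0' in Bx.
  right; split=> [x Jx||n [B FB Bun]].
  - by exists B0; rewrite //; apply: JB0.
  - split=> [|x y [B FB Bx] [C FC Cy]|a x [B FB Bx]].
    + by exists B0 => //; apply: JB0; apply: ideal0.
    + have [BC|CB] := Ftot B C FB FC.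
        by exists C => //; apply: idealD => //; [case: (Fgood C y)|apply: BC].
      by exists B => //; apply: idealD => //; [case: (Fgood B x)|apply: CB].
    + by exists B => //; apply: idealMl => //; case: (Fgood B x).
  - by have [_ _ /(_ n)] := Fgood B _ FB Bun.
have [JM idM avM] : good M.
  case: M0 => // M0; case: (Mmax J); last by right.
  by rewrite M0; split=> // /(_ 0 (ideal0 idJ)).
exists M; split=> //; last by rewrite -[u]expr1.
have enlarge x : ~ M x -> exists n a, M (u ^+ n - a * x).
  move=> Mx; apply: contrapT => noun.
  apply: (Mmax (fun y => exists a, M (y - a * x))).
    split=> [y My|sub]; first by exists 0; rewrite mul0r subr0.
    by apply: Mx; apply: sub; exists 1; rewrite mul1r subrr; apply: ideal0.
  right; split.
  - by move=> y Jy; exists 0; rewrite mul0r subr0; apply: JM.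
  - split=> [|y z [a Ma] [b Mb]|a y [b Mb]].
    + by exists 0; rewrite mul0r subr0; apply: ideal0.
    + exists (a + b); rewrite (_ : _ - _ = (y - a * x) + (z - b * x)); last by ring.
      exact: idealD.
    + exists (a * b); rewrite (_ : _ - _ = a * (y - b * x)); last by ring.
      exact: idealMl.
  - by move=> n [a Ma]; apply: noun; exists n, a.
split=> // [|x y Mxy]; first by rewrite -(expr0 u).
have [Mx|/enlarge[n [a Ma]]] := pselect (M x); first by left.
have [My|/enlarge[l [b Mb]]] := pselect (M y); first by right.
case: (avM (n + l)%N); rewrite exprD.
rewrite (_ : _ * _ = (u ^+ n - a * x) * u ^+ l + a * x * (u ^+ l - b * y)
  + (a * b) * (x * y)); last by ring.
by do 2?apply: idealD => //; [rewrite mulrC|..]; apply: idealMl.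
Qed.

(** * Prime ideals of A[X] over their contraction to A *)

Section OneVariable.
Variables (A : comNzRingType) (P : {poly A} -> Prop).
Hypothesis prP : is_prime P.

Let idP : is_ideal P. Proof. by case: prP. Qed.

Definition contraction (a : A) : Prop := P a%:P.
Local Notation PA := contraction.

Lemma contraction_prime : is_prime PA.
Proof.
case: prP => -[P0 PD PM] P1 Pm; split=> //.
  split=> [//|x y|a x]; rewrite /PA ?polyCD ?polyCM; [exact: PD|exact: PM].
by move=> x y; rewrite /PA polyCM => /Pm.
Qed.

Let idPA : is_ideal PA. Proof. by case: contraction_prime. Qed.

(* Membership in PA[X], the extension of the contraction. *)
Definition extended (h : {poly A}) : Prop := forall i, PA h`_i.

Lemma extended_ideal : is_ideal extended.
Proof.
split=> [i|x y ex ey i|a x ex i].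
- by rewrite coef0; apply: ideal0.
- by rewrite coefD; apply: idealD.
- by rewrite coefM; apply: ideal_sum => // j _; apply: idealMl.
Qed.

Lemma extended_sub h : extended h -> P h.
Proof.
move=> eh; rewrite -[h]coefK poly_def; apply: ideal_sum => // i _.
by rewrite -mul_polyC mulrC; apply: idealMl => //; apply: eh.
Qed.

(** Removing leading terms with coefficient in the contraction makes the size of h' the true size in
    (A/PA)[X]. Degrees modulo the contraction are thus handled without forming the quotient ring. *)
Lemma extended_trim (h : {poly A}) : exists2 h' : {poly A}, extended (h - h') &
  (size h' <= size h)%N /\ (h' = 0 \/ ~ PA (lead_coef h')).
Proof.
move: {2}(size h) (leqnn (size h)) => n; elim: n h => [|n IH] h.
  rewrite size_poly_leq0 => /eqP->; exists 0; last by split=> //; left.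
  by rewrite subrr; exact: (ideal0 extended_ideal).
move=> size_h; have [Pl|nPl] := pselect (PA (lead_coef h)); last first.
  exists h; last by split=> //; right.
  by rewrite subrr; exact: (ideal0 extended_ideal).
have [h0|h0] := eqVneq h 0.
  exists 0; last by rewrite size_poly0; split=> //; left.
  by rewrite h0 subrr; exact: (ideal0 extended_ideal).
pose g := lead_coef h *: 'X^((size h).-1).
have size_hg : (size (h - g)%R < size h)%N.
  rewrite -[ltnRHS]prednK ?size_poly_gt0 // ltnS.
  apply/leq_sizeP => j; rewrite leq_eqVlt => /orP[/eqP<-|lt_j].
    by rewrite coefB coefZ coefXn eqxx mulr1 lead_coefE subrr.
  rewrite coefB coefZ coefXn (gtn_eqF lt_j) mulr0 subr0 nth_default //.
  by rewrite -[leqLHS]prednK ?size_poly_gt0.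
have [|h' eh' [sz_h' h'P]] := IH (h - g); first by rewrite -ltnS (leq_trans size_hg).
exists h'; last by split=> //; apply: leq_trans sz_h' (ltnW size_hg).
rewrite (_ : h - h' = (h - g - h') + g); last by ring.
apply: (idealD extended_ideal) => // i.
by rewrite coefZ mulrC; apply: idealMl.
Qed.

(** Over the fraction field of A/PA the element r generates the image of S, being nonzero there of
    least degree. Pseudo-division by r or f takes the place of division over that field. *)
Lemma minimal_nonextended (S : {poly A} -> Prop) :
  is_ideal S -> (forall h, extended h -> S h) ->
  (exists2 h, S h & ~ extended h) ->
  exists r, [/\ S r, ~ PA (lead_coef r) &
    forall h, S h -> (size h < size r)%N -> extended h].
Proof.
move=> idS eS [h Sh neh].
have trimS g : S g -> ~ extended g ->
    exists g', [/\ S g', ~ PA (lead_coef g') & (size g' <= size g)%N].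
  move=> Sg neg; have [g' eg' [szg' [g'0|nPg']]] := extended_trim g.
    by case: neg; rewrite -[g]subr0 -g'0.
  by exists g'; split=> //; rewrite -[g'](subKr g); apply: idealB => //; apply: eS.
pose cand n := `[<exists r, [/\ S r, ~ PA (lead_coef r) & size r = n]>].
have [n /asboolP candn minn] : exists2 n, cand n & forall n', cand n' -> (n <= n')%N.
  have exn : exists n, cand n.
    have [g' [Sg' nPg' _]] := trimS h Sh neh.
    by exists (size g'); apply/asboolP; exists g'.
  by case: (ex_minnP exn) => n candn minn; exists n.
case: candn => r [Sr nPr szr]; exists r; split=> // g Sg lt_g.
apply: contrapT => neg; have [g' [Sg' nPg' szg']] := trimS g Sg neg.
have cand_g' : cand (size g') by apply/asboolP; exists g'.
by have := leq_trans (minn _ cand_g') szg'; rewrite -szr leqNgt lt_g.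
Qed.

Lemma pseudo_division (d p : {poly A}) : d != 0 ->
  exists s q r, lead_coef d ^+ s *: p = q * d + r /\ (size r < size d)%N.
Proof.
move=> d0; exists (Pdiv.CommonRing.rscalp p d), (Pdiv.CommonRing.rdivp p d),
  (Pdiv.CommonRing.rmodp p d).
by rewrite Pdiv.ComRing.rdivp_eq Pdiv.CommonRing.ltn_rmodp.
Qed.

Lemma nonext_lead h : ~ PA (lead_coef h) -> ~ extended h.
Proof. by move=> nPh eh; apply: nPh; rewrite lead_coefE; apply: eh. Qed.

Lemma nonext_neq0 h : ~ PA (lead_coef h) -> h != 0.
Proof.
by move=> nPh; apply/eqP => h0; apply: nPh; rewrite h0 lead_coef0; apply: ideal0.
Qed.

Lemma prime_scale c s h : ~ PA c -> P (c ^+ s *: h) -> P h.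
Proof.
case: (prP) => _ _ Pm nPc; rewrite -mul_polyC => /Pm[|//].
by rewrite -/(PA _) => /(prime_exp contraction_prime).
Qed.

(* Elimination: (b, P) contains a constant outside P, for f of minimal degree
   in P is irreducible modulo the contraction of P. *)
Lemma coprime_constant (b f : {poly A}) :
  ~ P b -> P f -> ~ PA (lead_coef f) ->
  (forall h, P h -> (size h < size f)%N -> extended h) ->
  exists a u h, [/\ ~ PA a, P h & a%:P = u * b + h].
Proof.
move=> nPb Pf nPf minf; case: (prP) => _ _ Pm.
pose S g := exists u h, P h /\ g = u * b + h.
have PS g : P g -> S g by move=> Pg; exists 0, g; rewrite mul0r add0r.
have idS : is_ideal S.
  split=> [|_ _ [u [h [Ph ->]]] [v [g [Pg ->]]]|a _ [u [h [Ph ->]]]].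
  - by apply: PS; apply: ideal0.
  - by exists (u + v), (h + g); split; [apply: idealD|ring].
  - by exists (a * u), (a * h); split; [apply: idealMl|ring].
have eS h : extended h -> S h by move/extended_sub/PS.
have [|r [Sr nPr minr]] := minimal_nonextended idS eS.
  by exists f; [apply: PS|apply: nonext_lead].
have [sz_r|sz_r] := leqP (size r) 1.
  case: Sr => u [h [Ph rE]]; exists r`_0, u, h.
  have r_c := size1_polyC sz_r; rewrite -r_c; split=> //.
  by move: nPr; rewrite {1}r_c lead_coefC.
(* The case of positive degree is impossible: r would be a proper common divisor of f and b modulo
   the contraction, or f would divide b. *)
exfalso.
have r0 := nonext_neq0 nPr.
have sz_rf : (size r <= size f)%N.
  rewrite leqNgt; apply/negP => /(minr _ (PS _ Pf)).
  exact: nonext_lead.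
(* If r lay in P it would have the size of f. The remainder of b by f then lies in S below the size
   of r, so it is extended, and b would be in P. *)
have nPr' : ~ P r.
  move=> Pr; have eq_sz : size r = size f.
    apply/eqP; rewrite eqn_leq sz_rf leqNgt; apply/negP => /(minf _ Pr).
    exact: nonext_lead.
  have [s [q [r' [divE sz_r']]]] := pseudo_division b (nonext_neq0 nPf).
  have : extended r'.
    apply: minr; last by rewrite eq_sz.
    exists (lead_coef f ^+ s)%:P, (- (q * f)); split.
      by apply: idealN => //; apply: idealMl.
    by rewrite mul_polyC divE; ring.
  move=> /extended_sub Pr'; apply: nPb; apply: (prime_scale nPf (s := s)).
  by rewrite divE; apply: idealD => //; apply: idealMl.
have [s [q [r' [divE sz_r']]]] := pseudo_division f r0.
have er' : extended r'.
  apply: minr => //; rewrite (_ : r' = (lead_coef r ^+ s)%:P * f - q * r).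
    by apply: (idealB idS); apply: (idealMl idS) => //; apply: PS.
  by rewrite mul_polyC divE; ring.
have Pqr : P (q * r).
  rewrite (_ : q * r = (lead_coef r ^+ s)%:P * f - r').
    by apply: idealB => //; [apply: idealMl|apply: extended_sub].
  by rewrite mul_polyC divE; ring.
have Pq : P q by case: (Pm _ _ Pqr).
(* With q zero modulo the contraction, a multiple of f by a power of [lead_coef r] would be
   extended. Otherwise q' lies in P, so it is at least as long as f, and the leading term of q' * r
   lies beyond all terms of f, where only extended polynomials contribute. *)
have [q' eq' [_ [q'0|nPq']]] := extended_trim q.
  have : P (lead_coef f *: (lead_coef r ^+ s)%:P).
    rewrite -mul_polyC -polyCM; change (PA (lead_coef f * lead_coef r ^+ s)).
    have : extended (lead_coef r ^+ s *: f).
      rewrite divE; apply: (idealD extended_ideal) => //.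
      by rewrite mulrC; apply: (idealMl extended_ideal); rewrite -[q]subr0 -q'0.
    by move=> /(_ (size f).-1); rewrite coefZ mulrC.
  have [_ _ PAm] := contraction_prime.
  rewrite -mul_polyC -polyCM => /PAm[//|/(prime_exp contraction_prime)//].
have Pq' : P q' by rewrite -[q'](subKr q); apply: idealB => //; apply: extended_sub.
have sz_q' : (size f <= size q')%N.
  by rewrite leqNgt; apply/negP => /(minf _ Pq'); apply: nonext_lead.
have [_ _ PAm] := contraction_prime.
have /PAm[] // : PA (lead_coef q' * lead_coef r).
rewrite mul_lead_coef (_ : q' * r = lead_coef r ^+ s *: f - (r' + (q - q') * r)).
  rewrite coefB coefZ [X in _ * X]nth_default ?mulr0 ?sub0r.
    apply: idealN => //; apply: (idealD extended_ideal) => //.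
    by rewrite mulrC; apply: (idealMl extended_ideal).
  case: (size r) sz_r (size q') sz_q' => [|[|n]] // _ n'.
  by rewrite !addnS /= => /leq_trans-> //; rewrite leq_addr.
by rewrite divE; ring.
Qed.

Lemma map_extended (L : comNzRingType) (phi : {rmorphism A -> L}) h :
  (forall x, PA x -> phi x = 0) -> extended h -> map_poly phi h = 0.
Proof.
by move=> phi0 eh; apply/polyP => i; rewrite coef_map coef0 /= phi0.
Qed.

(** The induction step on the number of variables: the condition b(w) != 0 is replaced by phi a != 0
    for a single a outside the contraction. For w take a root of the image of f: pseudo-division by
    f makes all of P vanish there, and a = u * b + h keeps b from vanishing. *)
Lemma extend_zero (L : closedFieldType) (b : {poly A}) : ~ P b ->
  exists2 a, ~ PA a & forall phi : {rmorphism A -> L},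
    (forall x, PA x -> phi x = 0) -> phi a != 0 ->
    exists2 w : L, forall h, P h -> (map_poly phi h).[w] = 0 &
      (map_poly phi b).[w] != 0.
Proof.
move=> nPb.
(* If P is generated by its contraction, every w satisfies the equations and only b(w) != 0 has to
   be arranged. *)
have [allP|/existsNP[f0 /not_implyP[Pf0 nef0]]] := pselect (forall h, P h -> extended h).
  have /existsNP[i nPi] : ~ extended b by move/extended_sub.
  exists b`_i => // phi phi0 phi_b.
  have : map_poly phi b != 0.
    by apply: contra_neq phi_b => b0; rewrite -coef_map b0 coef0.
  move=> /closed_nonrootP[w bw]; exists w => // h /allP/(map_extended phi0) ->.
  exact: horner0.
have [|f [Pf nPf minf]] := minimal_nonextended idP extended_sub; first by exists f0.
have [a [u [h0 [nPa Ph0 aE]]]] := coprime_constant nPb Pf nPf minf.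
exists (lead_coef f * a).
  by have [_ _ PAm] := contraction_prime => /PAm[].
move=> phi phi0; rewrite rmorphM mulf_eq0 negb_or => /andP[phi_f phi_a].
(* The image of f keeps its leading term. A constant f would put its leading coefficient in the
   contraction. *)
have : size (map_poly phi f) != 1%N.
  rewrite size_map_poly_id0 //; apply/eqP => sz_f; apply: nPf.
  have f_c := size1_polyC (eq_leq sz_f); rewrite f_c lead_coefC.
  by rewrite /contraction -f_c.
move=> /closed_rootP[w /rootP fw].
have zero h : P h -> (map_poly phi h).[w] = 0.
  move=> Ph; have [s [q [r [divE sz_r]]]] := pseudo_division h (nonext_neq0 nPf).
  have er : extended r.
    apply: minf => //; rewrite (_ : r = (lead_coef f ^+ s)%:P * h - q * f).
      by apply: idealB => //; apply: idealMl.
    by rewrite mul_polyC divE; ring.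
  have /eqP := congr1 (fun g => (map_poly phi g).[w]) divE.
  rewrite rmorphD rmorphM /= (map_extended phi0 er) addr0 hornerM fw mulr0.
  rewrite map_polyZ hornerZ rmorphXn mulf_eq0 expf_eq0 (negbTE phi_f) andbF /=.
  by move/eqP.
exists w => //; apply: contra_neq phi_a => bw.
have := congr1 (fun g => (map_poly phi g).[w]) aE.
rewrite /= rmorphD rmorphM /= hornerD hornerM bw mulr0 (zero _ Ph0) addr0.
by rewrite map_polyC hornerC.
Qed.

End OneVariable.

(** * Zeros of ideals of k[X_1, ..., X_n] in an algebraically closed field *)

Section Nullstellensatz.
Variables (k : fieldType) (L : closedFieldType) (iota : {rmorphism k -> L}).

Definition eval_at n (x : 'I_n -> L) (p : {mpoly k[n]}) : L := mmap iota x p.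

HB.instance Definition _ n (x : 'I_n -> L) := GRing.RMorphism.copy (eval_at x) (mmap iota x).

Lemma eval_at_map n (x : 'I_n -> L) p : (map_mpoly iota p).@[x] = eval_at x p.
Proof.
rewrite /map_mpoly /eval_at /mmap rmorph_sum /=; apply: eq_bigr => m _.
by rewrite mevalM mevalC mmap1_id mevalX.
Qed.

(** A left inverse of [muni], composed of ring morphisms. Primes of the polynomial ring in n + 1
    variables are pulled back along it. *)
Definition of_poly n (h : {poly {mpoly k[n]}}) : {mpoly k[n.+1]} :=
  (map_poly (@mwiden n k) h).['X_ord_max].

HB.instance Definition _ n := GRing.RMorphism.copy (@of_poly n)
  (horner_eval ('X_ord_max : {mpoly k[n.+1]}) \o map_poly (@mwiden n k)).

Lemma of_poly_muni n (p : {mpoly k[n.+1]}) : of_poly (muni p) = p.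
Proof.
rewrite muniE rmorph_sum [RHS]mpolyE; apply: eq_bigr => m _ /=.
rewrite /of_poly map_polyZ /= map_polyXn hornerZ hornerXn mwidenZ mwidenX -scalerAl.
congr (_ *: _); rewrite [X in X * _]mpolyXE_id [RHS]mpolyXE_id big_ord_recr /= [RHS]big_ord_recr /=.
rewrite mnmwiden_ordmax expr0 mulr1; congr (_ * _); apply: eq_bigr => i _.
by rewrite mnmwiden_widen mnmE.
Qed.

Definition snoc n (x : 'I_n -> L) (w : L) (i : 'I_n.+1) : L :=
  if unlift ord_max i is Some j then x j else w.

Lemma snoc_widen n (x : 'I_n -> L) w i : snoc x w (widen_ord (leqnSn n) i) = x i.
Proof.
have -> : widen_ord (leqnSn n) i = lift ord_max i.
  by apply: val_inj; rewrite /= /bump leqNgt ltn_ord.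
by rewrite /snoc liftK.
Qed.

Lemma snoc_max n (x : 'I_n -> L) w : snoc x w ord_max = w.
Proof. by rewrite /snoc unlift_none. Qed.

Lemma eval_at_widen n (x : 'I_n -> L) w p : eval_at (snoc x w) (mwiden p) = eval_at x p.
Proof.
rewrite /mwiden [in LHS]/mmap rmorph_sum; apply: eq_bigr => m _.
rewrite rmorphM /= {1}/eval_at mmapC; congr (_ * _).
rewrite rmorph_prod; apply: eq_bigr => i _; rewrite rmorphXn /=.
by rewrite /eval_at mmapX mmap1U snoc_widen.
Qed.

Lemma eval_at_of_poly n (x : 'I_n -> L) w h :
  eval_at (snoc x w) (of_poly h) = (map_poly (eval_at x) h).[w].
Proof.
rewrite /of_poly -horner_map /= -map_poly_comp /=.
rewrite {2}/eval_at mmapX mmap1U snoc_max; congr (_.[_]).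
by apply: eq_map_poly => p; apply: eval_at_widen.
Qed.

Lemma prime_zero n (P : {mpoly k[n]} -> Prop) (b : {mpoly k[n]}) :
  is_prime P -> ~ P b ->
  exists2 x : 'I_n -> L, forall h, P h -> eval_at x h = 0 & eval_at x b != 0.
Proof.
elim: n P b => [|n IH] P b prP nPb.
  have evalC (x : 'I_0 -> L) p : eval_at x p = iota p@_0%MM.
    by rewrite {1}[p]nvar0_mpolyC /eval_at mmapC.
  exists (fun=> 0) => [h Ph|]; rewrite evalC.
    have [h0|h0] := eqVneq h@_0%MM 0; first by rewrite h0 rmorph0.
    have [[P0 PD PM] P1 _] := prP; case: P1.
    rewrite (_ : 1 = (h@_0%MM)^-1%:MP * h); first exact: PM.
    by rewrite [X in _ * X]nvar0_mpolyC -mpolyCM mulVf.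
  rewrite fmorph_eq0; apply: contra_not_neq nPb => b0.
  by rewrite [b]nvar0_mpolyC b0 mpolyC0; case: prP => -[].
pose P' (h : {poly {mpoly k[n]}}) := P (of_poly h).
have prP' : is_prime P'.
  case: prP => -[P0 PD PM] P1 Pm; split; rewrite /P' ?rmorph1 //.
    split=> [|x y|a x]; rewrite ?rmorph0 ?rmorphD ?rmorphM //; [exact: PD|exact: PM].
  by move=> x y; rewrite rmorphM; apply: Pm.
have [|a nPa aP] := extend_zero prP' L (b := muni b); first by rewrite /P' of_poly_muni.
have [x xP xa] := IH _ a (contraction_prime prP') nPa.
have [w wP wb] := aP (eval_at x : {rmorphism _ -> _}) xP xa.
exists (snoc x w); last by rewrite -[b]of_poly_muni eval_at_of_poly.
move=> h Ph; rewrite -[h]of_poly_muni eval_at_of_poly; apply: wP.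
by rewrite /P' of_poly_muni.
Qed.

(** One form for two uses: u outside a radical ideal, and u = 1 for a proper ideal. *)
Lemma nullstellensatz n (J : {mpoly k[n]} -> Prop) (u : {mpoly k[n]}) :
  is_ideal J -> (forall i, ~ J (u ^+ i)) ->
  exists2 x : 'I_n -> L, forall h, J h -> eval_at x h = 0 & eval_at x u != 0.
Proof.
move=> idJ /(prime_avoiding_powers idJ)[P [prP JP nPu]].
have [x xP xu] := prime_zero prP nPu.
by exists x => // h /JP/xP.
Qed.

End Nullstellensatz.

(** * Linear dependence modulo the ideal *)

Lemma in_ideal_ideal (k : fieldType) m (F : seq {mpoly k[m]}) : is_ideal (in_ideal F).
Proof.
split=> [|_ _ [h ->] [h' ->]|a _ [h ->]].
- by exists (fun=> 0); rewrite big1 // => i _; rewrite mul0r.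
- by exists (fun p => h p + h' p); rewrite -big_split; apply: eq_bigr => p _; rewrite mulrDl.
- by exists (fun p => a * h p); rewrite mulr_sumr; apply: eq_bigr => p _; rewrite mulrA.
Qed.

(** A repeated entry of F would contribute f several times to the sum, and this multiplicity may
    vanish in k; hence [uniq F]. *)
Lemma in_ideal_gen (k : fieldType) m (F : seq {mpoly k[m]}) f :
  uniq F -> f \in F -> in_ideal F f.
Proof.
move=> uF fF; exists (fun p => (p == f)%:R).
rewrite (bigD1_seq f) //= eqxx mul1r big1 ?addr0 // => p /negbTE->.
by rewrite mul0r.
Qed.

Section Dependence.
Variables (k : fieldType) (L : closedFieldType) (iota : {rmorphism k -> L}).
Variables (s : seq k) (all_s : forall x, x \in s).
Variables (m : nat) (F : seq {mpoly k[m]}) (e : nat).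
Hypotheses (uF : uniq F) (radF : radical_ideal F) (le_e : at_most_solutions iota F e).

Definition is_zero (x : m.-tuple L) : Prop :=
  forall f, f \in F -> (map_mpoly iota f).@[tnth x] = 0.

Lemma is_zero_ideal (x : m.-tuple L) f :
  is_zero x -> in_ideal F f -> eval_at iota (tnth x) f = 0.
Proof.
move=> x0 [h ->]; rewrite rmorph_sum big_seq big1 // => g gF.
by rewrite rmorphM /= -[X in _ * X]eval_at_map x0 // mulr0.
Qed.

Lemma vanishing_in_ideal f :
  (forall x, is_zero x -> eval_at iota (tnth x) f = 0) -> in_ideal F f.
Proof.
move=> f0; apply: contrapT => nIf.
have [x xF xf] : exists2 x : 'I_m -> L,
    forall h, in_ideal F h -> eval_at iota x h = 0 & eval_at iota x f != 0.
  apply: nullstellensatz; first exact: in_ideal_ideal.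
  by move=> n /radF.
pose t := [tuple x i | i < m].
have tE p : eval_at iota (tnth t) p = eval_at iota x p.
  by rewrite -!eval_at_map; apply: meval_eq => i; rewrite tnth_mktuple.
move: xf; rewrite -tE f0 ?eqxx // => g gF.
by rewrite eval_at_map tE xF //; apply: in_ideal_gen.
Qed.

(** Take a relation over L of minimal support between the rows of values and scale one coefficient
    to 1. Its Frobenius conjugate is again a relation because Frobenius permutes the zeros. The
    difference of the two has smaller support, hence is zero, and the coefficients are fixed by
    Frobenius, so they lie in k. *)
Lemma dependent_mod_ideal (u : 'I_e.+1 -> {mpoly k[m]}) :
  exists2 c : 'I_e.+1 -> k, exists i, c i != 0 & in_ideal F (\sum_i c i *: u i).
Proof.
have [zs [zs_uniq zs_size zsP]] : exists zs : seq (m.-tuple L),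
    [/\ uniq zs, (size zs <= e)%N & forall x, x \in zs <-> is_zero x].
  exact: bounded_uniq_enum.
have [q [q_gt1 q_pchar qE]] := finite_field_Frobenius all_s.
have powk (x : k) : x ^+ q = x.
  have : root ('X^q - 'X) x by rewrite qE root_prod_XsubC mem_undup all_s.
  by rewrite rootE !hornerE subr_eq0 => /eqP.
have fixL (x : L) : x ^+ q = x -> exists c, x = iota c.
  move=> xq; have : root (map_poly iota ('X^q - 'X)) x.
    by rewrite rmorphB /= map_polyXn map_polyX rootE !hornerE xq subrr.
  rewrite qE rmorph_prod /= rootE horner_prod prodf_seq_eq0 => /hasP[c _ /=].
  rewrite rmorphB /= map_polyX map_polyC /= !hornerE subr_eq0 => /eqP->.
  by exists c.
have q_gt0 : (0 < q)%N by apply: ltnW.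
have powD (x y : L) : (x + y) ^+ q = x ^+ q + y ^+ q.
  by apply: exprDn_pchar; rewrite (eq_pnat _ (fmorph_pchar iota)).
have powN (x : L) : (- x) ^+ q = - x ^+ q.
  by apply/eqP; rewrite -addr_eq0 -powD addNr expr0n gtn_eqF.
have pow_sum I (r : seq I) (G : I -> L) : (\sum_(i <- r) G i) ^+ q = \sum_(i <- r) G i ^+ q.
  by apply: (big_morph (fun x => x ^+ q) powD); rewrite expr0n gtn_eqF.
have pow_inj (x y : L) : x ^+ q = y ^+ q -> x = y.
  move=> /eqP; rewrite -subr_eq0 -powN -powD expf_eq0 q_gt0 /=.
  by rewrite subr_eq0 => /eqP.
pose frob (x : m.-tuple L) := [tuple tnth x i ^+ q | i < m].
have eval_frob x p : eval_at iota (tnth (frob x)) p = eval_at iota (tnth x) p ^+ q.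
  rewrite /eval_at /mmap pow_sum; apply: eq_bigr => mu _.
  rewrite exprMn -rmorphXn powk /mmap1 -prodrXl; congr (_ * _).
  by apply: eq_bigr => i _; rewrite tnth_mktuple exprAC.
have frob_inj : injective frob.
  move=> x y xy; apply: eq_from_tnth => i; apply: pow_inj.
  by have := congr1 (fun t => tnth t i) xy; rewrite !tnth_mktuple.
(* An injective self-map of a finite list is onto. Every zero must be a conjugate z' ^ q, for the
   relation at z to be the q-th power of the one at z'. *)
have frob_zs z : z \in zs -> exists2 z', z' \in zs & z = frob z'.
  have sub : {subset map frob zs <= zs}.
    move=> _ /mapP[z' /zsP z'0 ->]; apply/zsP => f fF.
    by rewrite eval_at_map eval_frob -eval_at_map z'0 // expr0n gtn_eqF.
  have frob_uniq : uniq (map frob zs) by rewrite map_inj_uniq.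
  have [|_ <-] := uniq_min_size frob_uniq sub; first by rewrite size_map.
  by move=> /mapP[z' z'_in ->]; exists z'.
pose K (v : 'I_e.+1 -> L) := forall z, z \in zs ->
  \sum_i v i * eval_at iota (tnth z) (u i) = 0.
(* There are e + 1 rows of values at no more than e zeros, so the left kernel is nonzero. *)
have [v Kv [i0 vi0]] : exists2 v, K v & exists i, v i != 0.
  pose M := \matrix_(i < e.+1, j < size zs)
    eval_at iota (tnth (nth [tuple 0 | _ < m] zs j)) (u i).
  have /rowV0Pn[w /sub_kermxP wM /rV0Pn[i wi]] : kermx M != 0.
    rewrite -mxrank_eq0 mxrank_ker subn_eq0 -ltnNge.
    by rewrite (leq_ltn_trans (rank_leq_col M)) // ltnS.
  exists (w 0); last by exists i.
  move=> z /(nthP [tuple 0 | _ < m])[j lt_j <-].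
  have := congr1 (fun N : 'rV_(size zs) => N 0 (Ordinal lt_j)) wM.
  rewrite mxE [in X in _ = X -> _]mxE => wM0; rewrite -[RHS]wM0.
  by apply: eq_bigr => l _; rewrite [in RHS]mxE.
pose supp (v : 'I_e.+1 -> L) := #|[pred i | v i != 0]|.
have [n /asboolP[w [Kw [i1 wi1] w_n]] minn] : exists2 n,
    `[<exists w, [/\ K w, exists i, w i != 0 & supp w = n]>] &
    forall w, K w -> (exists i, w i != 0) -> (n <= supp w)%N.
  have exn : exists n, `[<exists w, [/\ K w, exists i, w i != 0 & supp w = n]>].
    by exists (supp v); apply/asboolP; exists v; split=> //; exists i0.
  case: (ex_minnP exn) => n nP minn; exists n => // w Kw w0.
  by apply: minn; apply/asboolP; exists w.
pose w1 i := w i / w i1.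
have Kw1 : K w1.
  move=> z /Kw w0; rewrite /w1.
  under eq_bigr do rewrite mulrAC; by rewrite -mulr_suml w0 mul0r.
pose w2 i := w1 i ^+ q - w1 i.
have Kw2 : K w2.
  move=> z z_in; rewrite /w2; under eq_bigr do rewrite mulrBl.
  rewrite sumrB Kw1 // subr0; have [z' z'_in ->] := frob_zs z z_in.
  under eq_bigr do rewrite eval_frob -exprMn.
  by rewrite -pow_sum Kw1 // expr0n gtn_eqF.
have w2_0 i : w2 i = 0.
  apply/eqP; apply: contraT => w2i.
  have := minn w2 Kw2 (ex_intro _ i w2i); rewrite -w_n leqNgt => /negP[].
  apply: proper_card; apply/properP; split.
    apply/fintype.subsetP => j; rewrite !inE; apply: contraNneq => wj.
    by rewrite /w2 /w1 wj mul0r expr0n gtn_eqF // subr0.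
  by exists i1; rewrite !inE ?wi1 // /w2 /w1 divff // expr1n subrr eqxx.
have /fin_all_exists[c cP] : forall i, exists c, w1 i = iota c.
  by move=> i; apply: fixL; apply/eqP; rewrite -subr_eq0; apply/eqP/w2_0.
exists c; first by exists i1; rewrite -(fmorph_eq0 iota) -cP /w1 divff ?oner_neq0.
apply: vanishing_in_ideal => x /zsP x_in; rewrite -[RHS](Kw1 x x_in) rmorph_sum.
by apply: eq_bigr => i _; rewrite cP /= /eval_at mmapZ.
Qed.

End Dependence.

(** * Total degrees, and representatives of low degree modulo I *)

Section Degrees.
Variables (k : fieldType) (m : nat).
Implicit Types (p q : {mpoly k[m]}) (mu nu : 'X_{1..m}).

Lemma msize_leP p n :
  reflect (forall mu, p@_mu != 0 -> (mdeg mu < n)%N) (msize p <= n)%N.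
Proof.
apply: (iffP idP) => [szp mu|szp].
  by rewrite mcoeff_eq0 negbK => /msize_mdeg_lt/leq_trans; apply.
rewrite msizeE; apply/bigmax_leqP_seq => mu mu_in _.
by apply: szp; rewrite mcoeff_eq0 negbK.
Qed.

Lemma msize_leD p q n : (msize p <= n -> msize q <= n -> msize (p + q) <= n)%N.
Proof. by move=> pn qn; apply: leq_trans (mmeasureD_le _ _ _) _; rewrite geq_max pn. Qed.

Lemma msize_leZ c p n : (msize p <= n -> msize (c *: p) <= n)%N.
Proof. by move=> pn; apply: leq_trans (mmeasureZ_le _ _ _) _. Qed.

Lemma msize_leB p q n : (msize p <= n -> msize q <= n -> msize (p - q) <= n)%N.
Proof. by move=> pn qn; apply: msize_leD; rewrite ?mmeasureN. Qed.

Lemma msize_le_sum (I : Type) (r : seq I) (Q : pred I) (G : I -> {mpoly k[m]}) n :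
  (forall i, Q i -> (msize (G i) <= n)%N) -> (msize (\sum_(i <- r | Q i) G i) <= n)%N.
Proof.
by move=> Gn; elim/big_rec: _ => [|i p Qi pn]; rewrite ?msize0 //; apply: msize_leD; auto.
Qed.

Lemma msize_leMX p mu n : (msize p <= n -> msize (p * 'X_[mu]) <= n + mdeg mu)%N.
Proof.
move=> pn; have [->|p0] := eqVneq p 0; first by rewrite mul0r msize0.
have X0 : 'X_[k, mu] != 0 by rewrite -msize_poly_eq0 msizeX.
by rewrite msizeM // msizeX addnS leq_add2r.
Qed.

Lemma divisor_of_degree mu n : (n <= mdeg mu)%N ->
  exists2 nu, (nu <= mu)%MM & mdeg nu = n.
Proof.
elim: n => [|n IH] lt_n.
  by exists 0%MM; rewrite ?mdeg0 //; apply/mnm_lepP => i; rewrite mnm0E.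
have [nu le_nu nu_n] := IH (ltnW lt_n).
have [i lt_i] : exists i, (nu i < mu i)%N.
  apply/existsP; apply: contraTT lt_n => /existsPn ge; rewrite -leqNgt -nu_n !mdegE.
  by apply: leq_sum => i _; rewrite leqNgt ge.
exists (nu + U_(i))%MM; last by rewrite mdegD mdeg1 nu_n addn1.
apply/mnm_lepP => j; rewrite mnmDE mnm1E; case: eqP => [<-|_]; first by rewrite addn1.
by rewrite addn0; apply/mnm_lepP.
Qed.

End Degrees.

Section Quotient.
Variables (k : fieldType) (L : closedFieldType) (iota : {rmorphism k -> L}).
Variables (s : seq k) (all_s : forall x, x \in s).
Variables (m : nat) (F : seq {mpoly k[m]}) (e : nat).
Hypotheses (uF : uniq F) (radF : radical_ideal F) (le_e : at_most_solutions iota F e).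

Let idI : is_ideal (in_ideal F) := in_ideal_ideal F.

(** Choose a divisor of mu in each degree 0, ..., e; these are dependent modulo I. Solve for the one
    of largest degree with nonzero coefficient and multiply by its cofactor in mu: the other terms
    get degree below that of mu. *)
Lemma reduce_monomial mu : (e <= mdeg mu)%N ->
  exists2 r : {mpoly k[m]}, (msize r <= mdeg mu)%N & in_ideal F ('X_[mu] - r).
Proof.
move=> le_mu.
have /fin_all_exists2[nu nu_le nu_deg] : forall i : 'I_e.+1,
    exists2 nu, (nu <= mu)%MM & mdeg nu = i.
  by move=> i; apply: divisor_of_degree; rewrite (leq_trans _ le_mu) // -ltnS.
have [c [i ci] cI] := dependent_mod_ideal all_s uF radF le_e (fun i => 'X_[nu i]).
case: (@arg_maxnP _ i (fun i => c i != 0) (fun i : 'I_e.+1 => i : nat) ci) => j cj maxj.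
pose r := - (c j)^-1 *: \sum_(l | l != j) c l *: 'X_[nu l + (mu - nu j)].
exists r.
  apply/msize_leZ/msize_le_sum => l lj.
  have [->|cl] := eqVneq (c l) 0; first by rewrite scale0r msize0.
  apply: msize_leZ; rewrite msizeX mdegD nu_deg.
  have lt_lj : (l < j)%N by rewrite ltn_neqAle val_eqE lj; apply: maxj.
  have := congr1 (@mdeg m) (submK (nu_le j)); rewrite mdegD nu_deg => <-.
  by rewrite addnC ltn_add2l.
rewrite (_ : _ - _ = ((c j)^-1 *: 'X_[mu - nu j]) * \sum_i c i *: 'X_[nu i]).
  exact: idealMl.
rewrite (bigD1 j) //= mulrDr -scalerAl -scalerAr -mpolyXD submK // scalerA mulVf // scale1r.
congr (_ + _); rewrite /r scaleNr opprK -scalerAl; congr (_ *: _).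
rewrite mulr_sumr; apply: eq_bigr => l _.
by rewrite -scalerAr -mpolyXD addmC.
Qed.

(** The bound on [msize] means degree < d. This strictness lets a linear form times r stay in degree
    <= d. *)
Lemma reduce_degree d (h : {mpoly k[m]}) : (e <= d)%N ->
  exists2 r : {mpoly k[m]}, (msize r <= d)%N & in_ideal F (h - r).
Proof.
move=> le_ed.
pose G (h : {mpoly k[m]}) := exists2 r : {mpoly k[m]}, (msize r <= d)%N & in_ideal F (h - r).
have GD h1 h2 : G h1 -> G h2 -> G (h1 + h2).
  move=> [r1 szr1 I1] [r2 szr2 I2]; exists (r1 + r2); first exact: msize_leD.
  by rewrite opprD addrACA; apply: idealD.
have GZ c h1 : G h1 -> G (c *: h1).
  move=> [r1 szr1 I1]; exists (c *: r1); first exact: msize_leZ.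
  by rewrite -scalerBr -mul_mpolyC; apply: idealMl.
have Gcong h1 h2 : G h2 -> in_ideal F (h1 - h2) -> G h1.
  move=> [r1 szr1 I1] I2; exists r1 => //.
  by rewrite -(subrK h2 h1) -addrA; apply: idealD.
have G0 : G 0 by exists 0; rewrite ?msize0 // subrr; apply: ideal0.
have G_sum p n : (msize p <= n)%N ->
    (forall mu, (mdeg mu < n)%N -> G 'X_[mu]) -> G p.
  move=> szp GX; rewrite [p]mpolyE big_seq; elim/big_rec: _ => // mu q mu_in Gq.
  by apply: GD => //; apply/GZ/GX; apply: leq_trans (msize_mdeg_lt mu_in) szp.
suff GX n mu : (mdeg mu < n)%N -> G 'X_[mu] by apply: (G_sum h _ (leqnn _) (GX _)).
elim: n mu => // n IH mu; rewrite ltnS leq_eqVlt => /predU1P[mu_n|/IH//].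
have [lt_mu|le_mu] := ltnP (mdeg mu) d.
  by exists 'X_[mu]; rewrite ?msizeX // subrr; apply: ideal0.
have [nu le_nu nu_d] := divisor_of_degree le_mu.
have [|r szr Ir] := @reduce_monomial nu; first by rewrite nu_d.
apply: (Gcong _ (r * 'X_[mu - nu])).
  apply: (G_sum _ n) => //.
  have := congr1 (@mdeg m) (submK le_nu); rewrite mdegD -mu_n => <-.
  by rewrite addnC; apply: msize_leMX.
rewrite -{1}(submK le_nu) mpolyXD mulrC -mulrBl mulrC.
exact: idealMl.
Qed.

Lemma univariate_in_ideal (i : 'I_m) :
  exists f : {mpoly k[m]}, [/\ in_ideal F f, f != 0 &
    forall mu, f@_mu != 0 -> exists2 j, (j <= e)%N & mu = (U_(i) *+ j)%MM].
Proof.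
have [c [l cl] cI] :=
  dependent_mod_ideal all_s uF radF le_e (fun j => 'X_[U_(i) *+ j]).
have Uinj : injective (fun j => U_(i) *+ j)%MM.
  move=> j j' /(congr1 (fun nu : 'X_{1..m} => nu i)).
  by rewrite !mulmnE mnm1E eqxx !mul1n.
exists (\sum_(j < e.+1) c j *: 'X_[U_(i) *+ j]); split=> //.
  apply: contra_neq cl => /(congr1 (mcoeff (U_(i) *+ l)%MM)).
  rewrite raddf_sum mcoeff0 (bigD1 l) //= big1 ?addr0.
    by rewrite mcoeffZ mcoeffX eqxx mulr1.
  move=> j jl; rewrite mcoeffZ mcoeffX (inj_eq Uinj) -(inj_eq val_inj) in jl *.
  by rewrite (negbTE jl) mulr0.
move=> mu; rewrite raddf_sum /= => nz.
have [j /eqP jmu] : exists j : 'I_e.+1, (U_(i) *+ j)%MM == mu.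
  apply/existsP; apply: contra_neqT nz => /existsPn no_j; apply: big1 => j _.
  by rewrite mcoeffZ mcoeffX (negbTE (no_j j)) mulr0.
by exists j; rewrite // -ltnS.
Qed.

End Quotient.

(** * Echelon bases *)

(** Each step either keeps a monomial or multiplies it by a variable, so that the bound (m + 1)^d on
    the length is immediate. *)
Fixpoint monomials (m d : nat) : seq 'X_{1..m} :=
  if d is d'.+1 then
    undup (flatten [seq nu :: [seq (nu + U_(i))%MM | i <- enum 'I_m] | nu <- monomials m d'])
  else [:: 0%MM].

Lemma mem_monomials m d mu : (mu \in monomials m d) = (mdeg mu <= d)%N.
Proof.
elim: d mu => [|d IH] mu; first by rewrite inE -mdeg_eq0 leqn0.
rewrite mem_undup; apply/flatten_mapP/idP => [[nu]|].
  rewrite IH inE => nu_d /predU1P[->|/mapP[i _ ->]]; first exact: leqW.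
  by rewrite mdegD mdeg1 addn1.
rewrite leq_eqVlt => /predU1P[mu_d|mu_d]; last first.
  by exists mu; rewrite ?IH // mem_head.
have [nu le_nu nu_d] : exists2 nu, (nu <= mu)%MM & mdeg nu = d.
  by apply: divisor_of_degree; rewrite mu_d.
exists nu; first by rewrite IH nu_d.
have := congr1 (@mdeg m) (submK le_nu); rewrite mdegD nu_d mu_d.
rewrite -addn1 addnC => /addnI/eqP/mdeg1P[i /eqP muE].
rewrite inE; apply/orP; right; apply/mapP; exists i; rewrite ?mem_enum //.
by rewrite addmC -muE submK.
Qed.

Lemma size_monomials m d : (size (monomials m d) <= m.+1 ^ d)%N.
Proof.
elim: d => [|d IH] //; apply: leq_trans (size_undup _) _.
rewrite size_flatten /shape -map_comp sumnE big_map.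
rewrite (eq_bigr (fun=> m.+1)) => [|nu _]; last by rewrite /= size_map size_enum_ord.
by rewrite big_const_seq count_predT iter_addn_0 expnS leq_mul2l IH orbT.
Qed.

Section Echelon.
Variables (k : fieldType) (m : nat).
Implicit Types (E : seq ('X_{1..m} * {mpoly k[m]})) (f g : {mpoly k[m]}).
Implicit Types (ord : seq 'X_{1..m}).

(** A single pass in order of insertion suffices for an echelon basis, because later elements vanish
    at earlier pivots. *)
Definition reduce E f := foldl (fun f p => f - f@_p.1 *: p.2) f E.

Fixpoint pivot ord f : option 'X_{1..m} :=
  if ord is mu :: ord' then if f@_mu == 0 then pivot ord' f else Some mu else None.

Definition insert ord E f :=
  let r := reduce E f in
  if pivot ord r is Some mu then rcons E (mu, (r@_mu)^-1 *: r) else E.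

Definition inserts ord E fs := foldl (insert ord) E fs.

Lemma reduce_rcons E p f :
  reduce (rcons E p) f = reduce E f - (reduce E f)@_p.1 *: p.2.
Proof. by rewrite /reduce foldl_rcons. Qed.

Lemma reduce0 E : reduce E 0 = 0.
Proof.
by elim/last_ind: E => // E p IH; rewrite reduce_rcons IH mcoeff0 scale0r subrr.
Qed.

Lemma reduceD E f g : reduce E (f + g) = reduce E f + reduce E g.
Proof.
elim/last_ind: E => // E p IH; rewrite !reduce_rcons IH mcoeffD scalerDl.
by rewrite opprD addrACA.
Qed.

Lemma reduceZ E c f : reduce E (c *: f) = c *: reduce E f.
Proof.
elim/last_ind: E => // E p IH; rewrite !reduce_rcons IH mcoeffZ.
by rewrite scalerBr scalerA.
Qed.

Definition lin_closed (S : {mpoly k[m]} -> Prop) : Prop :=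
  S 0 /\ forall c f g, S f -> S g -> S (f + c *: g).

Lemma lin_closed_sub S c f g : lin_closed S -> S f -> S g -> S (f - c *: g).
Proof. by move=> [_ SD] Sf Sg; rewrite -scaleNr; apply: SD. Qed.

Lemma lin_closed_kernel E : lin_closed (fun f => reduce E f = 0).
Proof.
split=> [|c f g f0 g0]; first exact: reduce0.
by rewrite reduceD reduceZ f0 g0 scaler0 addr0.
Qed.

Lemma reduce_closed S E f : lin_closed S -> (forall p, p \in E -> S p.2) ->
  S f -> S (reduce E f).
Proof.
move=> linS; elim: E f => //= p E IH f SE Sf; apply: IH => [q qE|].
  by apply: SE; rewrite inE qE orbT.
by apply: lin_closed_sub => //; apply: SE; rewrite mem_head.
Qed.

(** Membership in the span of E is expressed throughout as [reduce E f = 0]; this is the way from it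
    to any subspace containing E. *)
Lemma kernel_closed S E f : lin_closed S -> (forall p, p \in E -> S p.2) ->
  reduce E f = 0 -> S f.
Proof.
move=> linS; elim: E f => [f _ /= ->|p E IH f SE]; first by case: linS.
move=> /IH Sf; rewrite -(subrK (f@_p.1 *: p.2) f); case: (linS) => _; apply.
  by apply: Sf => q qE; apply: SE; rewrite inE qE orbT.
by apply: SE; rewrite mem_head.
Qed.

Lemma pivotP ord f : if pivot ord f is Some mu then mu \in ord /\ f@_mu != 0
  else forall mu, mu \in ord -> f@_mu = 0.
Proof.
elim: ord => //= nu ord IH; have [nu0|nu0] := eqVneq f@_nu 0.
  case: (pivot ord f) IH => [mu [mu_in fmu]|none]; first by rewrite inE mu_in orbT.
  by move=> mu; rewrite inE => /predU1P[->|/none].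
by rewrite mem_head.
Qed.

Lemma pivot_cat ord ord' f : pivot (ord ++ ord') f =
  if pivot ord f is Some mu then Some mu else pivot ord' f.
Proof. by elim: ord => //= mu ord ->; case: ifP. Qed.

Variables (mons : seq 'X_{1..m}) (small : pred 'X_{1..m}).

(* Looking for pivots outside [small] first makes the basis elements with a
   small pivot generate the [small]-supported part of the span. *)
Definition pivot_order : seq 'X_{1..m} :=
  [seq mu <- mons | ~~ small mu] ++ [seq mu <- mons | small mu].

Lemma mem_pivot_order mu : (mu \in pivot_order) = (mu \in mons).
Proof. by rewrite mem_cat !mem_filter; case: (small mu); rewrite ?orbF. Qed.

Lemma size_pivot_order : size pivot_order = size mons.
Proof. by rewrite size_cat !size_filter addnC count_predC. Qed.

Definition supported (Q : pred 'X_{1..m}) f : Prop := forall mu, f@_mu != 0 -> Q mu.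

Lemma lin_closed_supported Q : lin_closed (supported Q).
Proof.
split=> [mu|c f g Qf Qg mu]; first by rewrite mcoeff0 eqxx.
rewrite mcoeffD mcoeffZ; have [->|/Qf//] := eqVneq f@_mu 0.
by rewrite add0r mulf_eq0 negb_or => /andP[_ /Qg].
Qed.

Lemma supportedZ Q c f : supported Q f -> supported Q (c *: f).
Proof. by move=> Qf mu; rewrite mcoeffZ mulf_eq0 negb_or => /andP[_ /Qf]. Qed.

(** Triangular but not fully reduced: earlier elements may be nonzero at later pivots, so insertion
    never modifies what is already stored. *)
Inductive echelon : seq ('X_{1..m} * {mpoly k[m]}) -> Prop :=
| echelon_nil : echelon [::]
| echelon_rcons E mu b : echelon E -> mu \in mons -> b@_mu = 1 ->
    (forall p, p \in E -> b@_p.1 = 0) -> supported (mem mons) b ->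
    (small mu -> supported small b) -> echelon (rcons E (mu, b)).

Lemma echelon_supported E p : echelon E -> p \in E -> supported (mem mons) p.2.
Proof.
by elim=> // {}E mu b _ IH _ _ _ sb _; rewrite mem_rcons inE => /predU1P[->|/IH].
Qed.

Lemma echelon_small E p : echelon E -> p \in E -> small p.1 -> supported small p.2.
Proof.
by elim=> // {}E mu b _ IH _ _ _ _ sb; rewrite mem_rcons inE => /predU1P[->|/IH].
Qed.

Lemma echelon_pivot E p : echelon E -> p \in E -> p.1 \in mons.
Proof.
by elim=> // {}E mu b _ IH mu_in _ _ _ _; rewrite mem_rcons inE => /predU1P[->|/IH].
Qed.

Lemma echelon_pivot1 E p : echelon E -> p \in E -> p.2@_p.1 = 1.
Proof.
by elim=> // {}E mu b _ IH _ b1 _ _ _; rewrite mem_rcons inE => /predU1P[->|/IH].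
Qed.

Lemma echelon_size E : echelon E -> (size E <= size mons)%N.
Proof.
move=> echE; rewrite -(size_map fst); apply: uniq_leq_size; last first.
  by move=> _ /mapP[p pE ->]; apply: echelon_pivot pE.
elim: echE => // {}E mu b _ IH _ b1 b0 _ _; rewrite map_rcons rcons_uniq IH andbT.
by apply/mapP => -[p /b0 pE /= mu_p]; move: pE; rewrite -mu_p b1 => /eqP; rewrite oner_eq0.
Qed.

Lemma reduce_reduced E f p : echelon E -> p \in E -> (reduce E f)@_p.1 = 0.
Proof.
move=> echE; elim: echE p => // {}E mu b _ IH _ b1 b0 _ _ p.
rewrite reduce_rcons mem_rcons inE mcoeffB mcoeffZ /= => /predU1P[->|pE] /=.
  by rewrite b1 mulr1 subrr.
by rewrite IH // b0 // mulr0 subrr.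
Qed.

Lemma reduce_supported E f : echelon E -> supported (mem mons) f ->
  supported (mem mons) (reduce E f).
Proof.
by move=> echE; apply: reduce_closed (lin_closed_supported _) _ => p; apply: echelon_supported.
Qed.

(** During the pass f stays small-supported, so its coefficients at the other pivots are zero and
    the elements with these pivots are never subtracted. *)
Lemma reduce_small E f : echelon E -> supported small f ->
  reduce E f = reduce [seq p <- E | small p.1] f /\ supported small (reduce E f).
Proof.
move=> echE sf; elim: echE => // {}E mu b _ [IH sr] _ _ _ _ sb.
rewrite filter_rcons /=; case: ifPn => [/sb{}sb|nsmall].
  rewrite !reduce_rcons -IH; split=> //=.
  exact: lin_closed_sub (lin_closed_supported _) _ _.
rewrite reduce_rcons /=; have [->|/sr] := eqVneq (reduce E f)@_mu 0.
  by rewrite scale0r subr0.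
by move=> smu; rewrite smu in nsmall.
Qed.

Lemma echelon_insert E f : echelon E -> supported (mem mons) f ->
  echelon (insert pivot_order E f).
Proof.
move=> echE sf; have sr := reduce_supported echE sf.
rewrite /insert; have := pivotP pivot_order (reduce E f).
case pivE: (pivot pivot_order _) => [mu|//] [mu_in rmu]; constructor=> //.
- by rewrite -mem_pivot_order.
- by rewrite mcoeffZ mulVf.
- by move=> p pE; rewrite mcoeffZ reduce_reduced // mulr0.
- exact: supportedZ.
(* A small pivot is reached only after all coefficients outside [small] were found to be zero. *)
- move=> smu; apply: supportedZ => nu rnu; apply: contraT => nsnu.
  move: pivE; rewrite pivot_cat; have := pivotP [seq mu <- mons | ~~ small mu] (reduce E f).
  case: (pivot _ _) => [nu' [+ _] [nu'E]|none _].
    by rewrite nu'E mem_filter smu.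
  have nu_in : nu \in mons by exact: sr rnu.
  by move: rnu; rewrite none ?eqxx // mem_filter nsnu.
Qed.

Lemma insert_cat E f : exists E', insert pivot_order E f = E ++ E'.
Proof.
rewrite /insert; case: (pivot _ _) => [mu|]; last by exists [::]; rewrite cats0.
by exists [:: (mu, ((reduce E f)@_mu)^-1 *: reduce E f)]; rewrite cats1.
Qed.

Lemma kernel_cat E E' f : reduce E f = 0 -> reduce (E ++ E') f = 0.
Proof. by rewrite /reduce foldl_cat => ->; apply: reduce0. Qed.

Lemma insert_kernel E f : echelon E -> supported (mem mons) f ->
  reduce (insert pivot_order E f) f = 0.
Proof.
move=> echE sf; have sr := reduce_supported echE sf.
rewrite /insert; have := pivotP pivot_order (reduce E f).
case: (pivot _ _) => [mu [mu_in rmu]|none].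
  by rewrite reduce_rcons /= scalerA mulfV // scale1r subrr.
apply/mpolyP => mu; rewrite mcoeff0; have [//|rmu] := eqVneq (reduce E f)@_mu 0.
by apply: none; rewrite mem_pivot_order; apply: sr.
Qed.

Lemma inserts_cat E fs : exists E', inserts pivot_order E fs = E ++ E'.
Proof.
elim: fs E => [|f fs IH] E /=; first by exists [::]; rewrite cats0.
have [E1 ->] := insert_cat E f; have [E2 ->] := IH (E ++ E1).
by exists (E1 ++ E2); rewrite catA.
Qed.

Lemma inserts_kernel_sub E fs f : reduce E f = 0 -> reduce (inserts pivot_order E fs) f = 0.
Proof. by have [E' ->] := inserts_cat E fs; apply: kernel_cat. Qed.

Lemma echelon_inserts E fs : echelon E -> (forall f, f \in fs -> supported (mem mons) f) ->
  echelon (inserts pivot_order E fs).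
Proof.
elim: fs E => //= f fs IH E echE sfs; apply: IH.
  by apply: echelon_insert => //; apply: sfs; rewrite mem_head.
by move=> g gfs; apply: sfs; rewrite inE gfs orbT.
Qed.

Lemma inserts_kernel E fs f : echelon E -> (forall f, f \in fs -> supported (mem mons) f) ->
  f \in fs -> reduce (inserts pivot_order E fs) f = 0.
Proof.
elim: fs E => //= g fs IH E echE sfs.
have sg : supported (mem mons) g by apply: sfs; rewrite mem_head.
rewrite inE => /predU1P[->|f_in].
  exact: inserts_kernel_sub (insert_kernel echE sg).
apply: IH => //; first exact: echelon_insert.
by move=> h hfs; apply: sfs; rewrite inE hfs orbT.
Qed.

Lemma insert_closed S E f : lin_closed S -> (forall p, p \in E -> S p.2) -> S f ->
  forall p, p \in insert pivot_order E f -> S p.2.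
Proof.
move=> linS SE Sf p; rewrite /insert; case: (pivot _ _) => [mu|]; last exact: SE.
rewrite mem_rcons inE => /predU1P[->|/SE//] /=.
case: (linS) => S0 SD; rewrite -[_ *: _]add0r; apply: SD => //.
exact: reduce_closed.
Qed.

Lemma inserts_closed S E fs : lin_closed S -> (forall p, p \in E -> S p.2) ->
  (forall f, f \in fs -> S f) -> forall p, p \in inserts pivot_order E fs -> S p.2.
Proof.
move=> linS; elim: fs E => //= f fs IH E SE Sfs; apply: IH.
  by apply: insert_closed => //; apply: Sfs; rewrite mem_head.
by move=> g gfs; apply: Sfs; rewrite inE gfs orbT.
Qed.

End Echelon.

(** * The space V_{F,d} *)

Section Closure.
Variables (k : fieldType) (m d : nat).
Implicit Types (E : seq ('X_{1..m} * {mpoly k[m]})) (f g : {mpoly k[m]}).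

Let mons := monomials m d.

Definition low_degree : pred 'X_{1..m} := fun mu => (mdeg mu < d)%N.

Definition degree_order : seq 'X_{1..m} := pivot_order mons low_degree.

(** A pivot of degree < d forces degree < d, as pivots of degree d are tried first. These elements
    span the part of degree < d, and their products with a variable stay in degree <= d. *)
Definition products E : seq {mpoly k[m]} :=
  [seq p.2 * 'X_i | p <- [seq p <- E | (mdeg p.1 < d)%N], i <- enum 'I_m].

Definition fall_step E := inserts degree_order E (products E).

Definition fall_closure E := iter (size mons) fall_step E.

Lemma supported_monomials f : supported (mem mons) f <-> (msize f <= d.+1)%N.
Proof.
split=> [sf|szf mu]; first by apply/msize_leP => mu /sf /=; rewrite mem_monomials.
by rewrite /= mem_monomials -ltnS => /(msize_leP _ _ szf).
Qed.

Lemma supported_low f : supported low_degree f <-> (msize f <= d)%N.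
Proof. by split=> [sf|szf mu]; [apply/msize_leP|move/(msize_leP _ _ szf)]. Qed.

Local Notation echelonD := (echelon mons low_degree).

Lemma products_supported E f : echelonD E -> f \in products E -> supported (mem mons) f.
Proof.
move=> echE /allpairsP[[p i] [/=]]; rewrite mem_filter => /andP[low pE] _ ->.
apply/supported_monomials; rewrite -addn1 -[in X in (_ <= _ + X)%N](mdeg1 i).
by apply: msize_leMX; apply/supported_low; exact: (echelon_small echE pE low).
Qed.

Lemma echelon_step E : echelonD E -> echelonD (fall_step E).
Proof. by move=> echE; apply: echelon_inserts => // f; apply: products_supported. Qed.

Lemma echelon_iter_step n E : echelonD E -> echelonD (iter n fall_step E).
Proof. by move=> echE; elim: n => //= n IH; apply: echelon_step. Qed.

Lemma step_grows E : fall_step E = E \/ (size E < size (fall_step E))%N.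
Proof.
rewrite /fall_step; have [[|p E'] ->] := inserts_cat mons low_degree E (products E).
  by left; rewrite cats0.
by right; rewrite size_cat /= -addSnnS leq_addr.
Qed.

(** A step adds an element or changes nothing, and an echelon basis has at most [size mons]
    elements; that many steps therefore reach a fixed point. *)
Lemma closure_stable E : echelonD E -> fall_step (fall_closure E) = fall_closure E.
Proof.
move=> echE; rewrite /fall_closure; set n := size mons.
have [[j le_jn jP]|nofix] := pselect (exists2 j, (j <= n)%N &
    fall_step (iter j fall_step E) = iter j fall_step E).
  by rewrite -(subnK le_jn) iterD iter_fix.
have grow j : (j <= n.+1)%N -> (j <= size (iter j fall_step E))%N.
  elim: j => // j IH le_j; have [fixj|lt_j] := step_grows (iter j fall_step E).
    by case: nofix; exists j.
  by apply: leq_ltn_trans lt_j; apply: IH; apply: ltnW.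
have := grow _ (leqnn _).
by rewrite leqNgt ltnS (echelon_size (echelon_iter_step n.+1 echE)).
Qed.

Lemma closure_sub E f : reduce E f = 0 -> reduce (fall_closure E) f = 0.
Proof. by move=> f0; rewrite /fall_closure; elim: (size mons) => //= n; apply: inserts_kernel_sub. Qed.

(** By [reduce_small], f is a combination of the elements of degree < d, whose products with X_i are
    inserted by a further step; by stability that step changes nothing. *)
Lemma closure_mulX E f i : echelonD E -> (msize f <= d)%N ->
  reduce (fall_closure E) f = 0 -> reduce (fall_closure E) (f * 'X_i) = 0.
Proof.
move=> echE szf f0; have echC : echelonD (fall_closure E) by apply: echelon_iter_step.
have /(reduce_small echC)[] : supported low_degree f by apply/supported_low.
rewrite f0 => /esym/(kernel_closed (S := fun g => reduce (fall_closure E) (g * 'X_i) = 0)) + _.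
apply.
  case: (lin_closed_kernel (fall_closure E)) => S0 SD; split=> [|c g h g0 h0].
    by rewrite mul0r.
  by rewrite mulrDl -scalerAl; apply: SD.
move=> p; rewrite mem_filter => /andP[low pC].
rewrite -{1}closure_stable // /fall_step; apply: inserts_kernel => //.
  by move=> g; apply: products_supported.
by apply/allpairsP; exists (p, i); rewrite mem_filter pC /= mem_enum andbT.
Qed.

Lemma closure_mulXn E f mu : echelonD E -> (msize f + mdeg mu <= d.+1)%N ->
  reduce (fall_closure E) f = 0 -> reduce (fall_closure E) (f * 'X_[mu]) = 0.
Proof.
move=> echE; move nE: (mdeg mu) => n; elim: n mu nE f => [|n IH] mu mu_n f szf f0.
  by move/eqP: mu_n; rewrite mdeg_eq0 => /eqP->; rewrite mpolyX0 mulr1.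
have [i mui] : exists i, (0 < mu i)%N.
  apply/existsP; apply: contra_eqT mu_n => /existsPn mu0; rewrite mdegE big1 // => i _.
  by apply/eqP; rewrite -leqn0 leqNgt mu0.
have le_mu : (U_(i) <= mu)%MM by rewrite lep1mP -lt0n.
have mu_n' : mdeg (mu - U_(i)) = n.
  by have := congr1 (@mdeg m) (submK le_mu); rewrite mdegD mdeg1 mu_n addn1 => -[].
rewrite -(submK le_mu) mpolyXD mulrA mulrAC; apply: (IH _ mu_n').
  by rewrite (leq_trans _ szf) // addnS -addSn leq_add2r -addn1 -(mdeg1 i) msize_leMX.
by apply: closure_mulX => //; rewrite addnS ltnS in szf; apply: leq_trans (leq_addr _ _) szf.
Qed.

(** Degrees add, so each monomial of g alone keeps the product with f in degree <= d, and g can be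
    treated term by term. *)
Lemma closure_mul E f g : echelonD E -> (msize (g * f) <= d.+1)%N ->
  reduce (fall_closure E) f = 0 -> reduce (fall_closure E) (g * f) = 0.
Proof.
move=> echE szgf f0.
have [->|nzf] := eqVneq f 0; first by rewrite mulr0 reduce0.
have [->|nzg] := eqVneq g 0; first by rewrite mul0r reduce0.
rewrite msizeM // in szgf; rewrite [g]mpolyE mulr_suml big_seq.
case: (lin_closed_kernel (fall_closure E)) => S0 SD.
elim/big_rec: _ => // mu h mu_in h0; rewrite addrC -scalerAl; apply: SD => //.
rewrite mulrC; apply: closure_mulXn => //; apply: leq_trans szgf.
have := msize_mdeg_lt mu_in; rewrite -(ltn_predK (m := 0) (n := msize g)); last first.
  by rewrite lt0n msize_poly_eq0.
by rewrite ltnS addSn /= addnC => ?; rewrite leq_add2r.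
Qed.

Variables (F : seq {mpoly k[m]}).

(** Selection by index and degree follows what the tree may depend on, and keeps the order in which
    the program lists its input vectors. *)
Definition generators : seq {mpoly k[m]} :=
  [seq nth 0 F j | j <- iota 0 (size F) & (tdeg (nth 0%R F j) <= d)%N].

Definition ideal_basis := fall_closure (inserts degree_order [::] generators).

Lemma mem_generators f : f \in generators <-> f \in F /\ (msize f <= d.+1)%N.
Proof.
have tdegP g : (tdeg g <= d)%N = (msize g <= d.+1)%N by rewrite /tdeg; case: (msize g).
split=> [/mapP[j]|[/(nthP 0)[j lt_j <-] szf]].
  rewrite mem_filter mem_iota tdegP => /andP[szf /andP[_ lt_j]] ->.
  by split=> //; apply: mem_nth.
by apply/mapP; exists j; rewrite // mem_filter mem_iota tdegP szf.
Qed.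

Lemma generators_supported f : f \in generators -> supported (mem mons) f.
Proof. by move=> /mem_generators[_ szf]; apply/supported_monomials. Qed.

Lemma echelon_ideal_basis : echelonD ideal_basis.
Proof.
apply/echelon_iter_step/echelon_inserts => // [|f]; first exact: echelon_nil.
exact: generators_supported.
Qed.

Lemma fall_space_kernel f : fall_space F d f -> reduce ideal_basis f = 0.
Proof.
have ech0 : echelonD (inserts degree_order [::] generators).
  by apply: echelon_inserts => // [|g]; [exact: echelon_nil|exact: generators_supported].
case: (lin_closed_kernel ideal_basis) => S0 SD.
elim=> // {f} [f fF szf|g h _ g0 szhg|f g _ f0 _ g0|c f _ f0].
- apply: closure_sub; apply: inserts_kernel; first exact: echelon_nil.
    by move=> g; apply: generators_supported.
  exact/mem_generators.
- exact: closure_mul.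
- by rewrite -[g]scale1r; apply: SD.
- by rewrite -[_ *: _]add0r; apply: SD.
Qed.

Lemma lin_closed_ideal : lin_closed (in_ideal F).
Proof.
have idI := in_ideal_ideal F; split=> [|c f g If Ig]; first exact: ideal0.
by rewrite -mul_mpolyC; apply: idealD => //; apply: idealMl.
Qed.

Lemma ideal_basis_sub p : uniq F -> p \in ideal_basis -> in_ideal F p.2.
Proof.
move=> uF; have idI := in_ideal_ideal F.
rewrite /ideal_basis /fall_closure.
elim: (size mons) p => /= [|n IH].
  apply: inserts_closed => //; first exact: lin_closed_ideal.
  by move=> f /mem_generators[fF _]; apply: in_ideal_gen.
apply: inserts_closed; [exact: lin_closed_ideal|exact: IH|].
move=> f /allpairsP[[p i] [/=]]; rewrite mem_filter => /andP[_ pE] _ ->.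
by rewrite mulrC; apply: idealMl => //; apply: IH.
Qed.

(** V_{F,i} grows with i, so [fall_bound] at dF <= d puts f in V_{F,d}. Together with
    [ideal_basis_sub], the span is exactly the part of I of degree <= d. *)
Lemma ideal_basis_kernel dF f : is_last_fall_degree F (Some dF) -> (dF <= d)%N ->
  in_ideal F f -> (msize f <= d.+1)%N -> reduce ideal_basis f = 0.
Proof.
move=> [fallF _] le_d If szf; apply: fall_space_kernel.
have sub i j g : (i <= j)%N -> fall_space F i g -> fall_space F j g.
  move=> le_ij; have degij h : deg_le h i -> deg_le h j.
    by rewrite /deg_le => /leq_trans; apply; rewrite ltnS.
  elim=> {g} [g gF /degij|g h _ IH /degij|//|g h _ Sg _ Sh|c g _ Sg].
  - exact: fall_gen.
  - exact: fall_mul.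
  - exact: fall_zero.
  - exact: fall_add.
  - exact: fall_scale.
apply: sub (fallF f If); rewrite geq_max le_d /tdeg.
by case: (msize f) szf.
Qed.

End Closure.

(** * Search for the solutions *)

Section Search.
Variables (k : fieldType) (m d : nat).
Implicit Types (B : seq ('X_{1..m} * {mpoly k[m]})) (f g : {mpoly k[m]}) (al : seq k).

Definition linear_index (n : nat) : seq ('I_m * 'X_{1..m}) :=
  [seq (l, nu) | l <- [seq l : 'I_m <- enum 'I_m | (l < n)%N], nu <- monomials m d.-1].

Definition linear_form al (x : 'I_m * 'X_{1..m}) : {mpoly k[m]} :=
  ((nth 0 al x.1)%:MP - 'X_(x.1)) * 'X_[x.2].

Definition specialize B al :=
  inserts (degree_order m d) B (map (linear_form al) (linear_index (size al))).

(** A pivot exists exactly when the reduction of 1 is nonzero; the program can find it by tests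
    alone. *)
Definition alive B al : bool :=
  isSome (pivot (degree_order m d) (reduce (specialize B al) 1)).

Definition is_power (i : 'I_m) : pred 'X_{1..m} := fun mu => mu == (U_(i) *+ mu i)%MM.

(** Elimination by the same device of pivot order: with powers of X_i tried last, the elements with
    such a pivot span the polynomials in X_i alone within the span of B. *)
Definition power_basis B (i : 'I_m) :=
  inserts (pivot_order (monomials m d) (is_power i)) [::] (map snd B).

Definition eliminant B i : option {mpoly k[m]} :=
  ohead [seq p.2 | p <- power_basis B i & is_power i p.1].

(** A nonlinear factor with nonzero coefficient at X yields a spurious candidate. It is harmless,
    since candidates are filtered by [alive], and it does not affect the bound on their number.
    Linear factors are never missed. *)
Definition add_root (acc : seq k) (p : seq k) : seq k :=
  if nth 0 p 1 == 0 then acc else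
  let a := 0 - nth 0 p 0 / nth 0 p 1 in
  if a \in acc then acc else a :: acc.

Definition linear_roots (out : seq (seq k)) : seq k := foldl add_root [::] out.

Definition power_coefs (i : 'I_m) f : 'I_d.+1 -> k := fun j => f@_(U_(i) *+ j).

Variable (fac : ctree k 'I_d.+1).

Definition candidates B i : seq k :=
  if eliminant B i is Some f then linear_roots (output (power_coefs i f) fac) else [::].

Definition extend_solutions B (sols : seq (seq k)) (i : 'I_m) : seq (seq k) :=
  [seq al <- [seq rcons al a | al <- sols, a <- candidates B i] | alive B al].

Definition search B : seq (seq k) :=
  foldl (extend_solutions B) [seq al <- [:: [::]] | alive B al] (enum 'I_m).

End Search.

(** * Roots read off a factorization *)

Section Roots.
Variables (k : fieldType).
Implicit Types (out : seq (seq k)).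

Lemma roots_rcons out p : linear_roots (rcons out p) = add_root (linear_roots out) p.
Proof. by rewrite /linear_roots foldl_rcons. Qed.

Lemma size_roots out : (size (linear_roots out) <= size out)%N.
Proof.
elim/last_ind: out => // out p IH; rewrite roots_rcons size_rcons /add_root.
by case: ifP => _; [apply: leqW|case: ifP => _; [apply: leqW|]].
Qed.

Lemma uniq_roots out : uniq (linear_roots out).
Proof.
elim/last_ind: out => // out p IH; rewrite roots_rcons /add_root.
by case: ifP => // _; case: ifPn => //= ->.
Qed.

Lemma mem_roots out p x : p \in out -> nth 0 p 1 != 0 ->
  nth 0 p 0 + nth 0 p 1 * x = 0 -> x \in linear_roots out.
Proof.
move=> p_in p1 px; have xE : x = 0 - nth 0 p 0 / nth 0 p 1.
  have -> : nth 0 p 0 = - (nth 0 p 1 * x) by apply/eqP; rewrite -addr_eq0 px.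
  by rewrite sub0r mulNr opprK mulrC mulKf.
elim/last_ind: out p_in => // out q IH; rewrite mem_rcons inE roots_rcons /add_root.
case/predU1P=> [<-|/IH x_in].
  by rewrite (negbTE p1) -xE; case: ifPn => // _; rewrite mem_head.
by case: ifP => // _; case: ifP => // _; rewrite inE x_in orbT.
Qed.

Lemma factorization_roots (f : {poly k}) out x :
  is_factorization f out -> f != 0 -> root f x -> x \in linear_roots out.
Proof.
move=> [irr [c fE]] f0; rewrite fE rootZ; last first.
  by apply: contra_neq f0 => c0; rewrite fE c0 scale0r.
rewrite rootE horner_prod prodf_seq_eq0 => /hasP[p p_in /= px].
by have [p1 p01] := irreducible_root_coef (irr p p_in) px; apply: mem_roots p_in p1 p01.
Qed.

Lemma factorization_size (f : {poly k}) out :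
  is_factorization f out -> f != 0 -> (size out < size f)%N.
Proof.
move=> [irr [c fE]] f0.
have c0 : c != 0 by apply: contra_neq f0 => c0; rewrite fE c0 scale0r.
rewrite fE size_scale //; elim: out irr {fE} => [|p out IH] irr.
  by rewrite big_nil size_poly1.
have [sp _] := irr p (mem_head _ _).
have p0 : Poly p != 0 by rewrite -size_poly_gt0 (ltn_trans _ sp).
have IH' := IH (fun q q_in => irr q (mem_behead (s := p :: out) q_in)).
have prod0 : \prod_(q <- out) Poly q != 0 by rewrite -size_poly_gt0 (leq_trans _ IH').
rewrite big_cons size_mul //=.
by move: sp IH'; case: (size (Poly p)) => [|[|n]] //=; lia.
Qed.

End Roots.

(** * Correctness of the search *)

Section SearchCorrect.
Variables (k : fieldType) (L : closedFieldType) (iota : {rmorphism k -> L}).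
Variables (s : seq k) (all_s : forall x, x \in s).
Variables (m : nat) (F : seq {mpoly k[m]}) (e dF d : nat).
Hypotheses (uF : uniq F) (radF : radical_ideal F) (le_e : at_most_solutions iota F e).
Hypotheses (lastF : is_last_fall_degree F (Some dF)) (le_dF : (dF <= d)%N).
Hypotheses (le_ed : (e <= d)%N) (d_gt0 : (0 < d)%N).

Let mons := monomials m d.
Let B := ideal_basis d F.
Let idI : is_ideal (in_ideal F) := in_ideal_ideal F.

Lemma linear_form_supported (al : seq k) x :
  x \in linear_index m d (size al) -> supported (mem mons) (linear_form al x).
Proof.
case/allpairsP=> -[l nu] [/= _]; rewrite mem_monomials => nu_d ->.
apply/supported_monomials; apply: leq_trans (_ : 2 + mdeg nu <= _)%N.
  apply: msize_leMX; apply: msize_leB; last by rewrite msizeX mdeg1.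
  by rewrite mmeasureC; case: (_ != 0).
by rewrite addSn ltnS addSn -[d]prednK // ltnS.
Qed.

Lemma echelon_specialize al : echelon mons (@low_degree m d) (specialize d B al).
Proof.
apply: echelon_inserts; first exact: echelon_ideal_basis.
by move=> f /mapP[x x_in ->]; apply: linear_form_supported.
Qed.

(** Suppose 1 is congruent modulo I to a sum of (a_l - X_l) g_l. Replacing each g_l by a
    representative of degree < d leaves an element of I of degree <= d, which the basis reduces to
    0; then 1 reduces to 0 as well. So an alive tuple gives a proper ideal, and the Nullstellensatz
    with u = 1 applies. *)
Lemma alive_zero (al : seq k) : alive d B al ->
  exists2 x : m.-tuple L, is_zero iota F x &
    forall l : 'I_m, (l < size al)%N -> tnth x l = iota (nth 0 al l).
Proof.
move=> live; pose lf (l : 'I_m) : {mpoly k[m]} := (nth 0 al l)%:MP - 'X_l.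
pose J (h : {mpoly k[m]}) := exists g : 'I_m -> {mpoly k[m]},
  in_ideal F (h - \sum_(l < m | (l < size al)%N) lf l * g l).
have idJ : is_ideal J.
  split=> [|h1 h2 [g1 I1] [g2 I2]|a h [g Ig]].
  - exists (fun=> 0); rewrite big1 ?subr0; first exact: ideal0.
    by move=> l _; rewrite mulr0.
  - exists (fun l => g1 l + g2 l); under eq_bigr do rewrite mulrDr.
    by rewrite big_split opprD addrACA; apply: idealD.
  - exists (fun l => a * g l); under eq_bigr do rewrite mulrCA.
    by rewrite -mulr_sumr -mulrBr; apply: idealMl.
have nJ1 : ~ J 1.
  move=> [g Ig].
  have /fin_all_exists2[r szr Ir] : forall l, exists2 r : {mpoly k[m]},
      (msize r <= d)%N & in_ideal F (g l - r).
    by move=> l; apply: (reduce_degree all_s uF radF le_e).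
  have Ir1 : in_ideal F (1 - \sum_(l < m | (l < size al)%N) lf l * r l).
    rewrite -[1](subrK (\sum_(l < m | (l < size al)%N) lf l * g l)) -addrA.
    apply: idealD => //; rewrite -sumrB; apply: ideal_sum => // l _.
    by rewrite -mulrBr; apply: idealMl.
  case: (lin_closed_kernel (specialize d B al)) => K0 KD.
  have kerl (l : 'I_m) nu : (l < size al)%N -> (mdeg nu < d)%N ->
      reduce (specialize d B al) (lf l * 'X_[nu]) = 0.
    move=> lt_l lt_nu; apply: inserts_kernel; first exact: echelon_ideal_basis.
      by move=> f /mapP[x x_in ->]; apply: linear_form_supported.
    apply/mapP; exists (l, nu) => //; apply/allpairsP; exists (l, nu).
    by rewrite mem_filter lt_l mem_enum mem_monomials -ltnS prednK.
  have ker1 (l : 'I_m) : (l < size al)%N -> reduce (specialize d B al) (lf l * r l) = 0.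
    move=> lt_l; rewrite [r l]mpolyE mulr_sumr big_seq.
    elim/big_rec: _ => // mu h mu_in h0; rewrite addrC -scalerAr; apply: KD => //.
    by apply: kerl => //; apply: leq_trans (msize_mdeg_lt mu_in) (szr l).
  have sum0 : reduce (specialize d B al) (\sum_(l < m | (l < size al)%N) lf l * r l) = 0.
    by elim/big_rec: _ => // l h lt_l h0; rewrite addrC -[_ * _]scale1r; apply: KD => //; apply: ker1.
  have one0 : reduce (specialize d B al) 1 = 0.
    rewrite -[1](subrK (\sum_(l < m | (l < size al)%N) lf l * r l)).
    rewrite -[X in _ + X]scale1r; apply: KD => //; apply: inserts_kernel_sub.
    apply: (ideal_basis_kernel lastF) => //; apply: msize_leB; first by rewrite msize1.
    apply: msize_le_sum => l _; rewrite mulrC mulrBr.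
    apply: msize_leB; last by rewrite -addn1 -(mdeg1 l); apply: msize_leMX.
    by rewrite mulrC mul_mpolyC; apply/msize_leZ/leqW.
  have := pivotP (degree_order m d) (reduce (specialize d B al) 1).
  move: live; rewrite /alive; case: (pivot _ _) => // mu _ [_].
  by rewrite one0 mcoeff0 eqxx.
have [x xJ _] := nullstellensatz iota idJ (u := 1)
  (fun i => eq_ind_r (fun y => ~ J y) nJ1 (expr1n _ i)).
have JI f : in_ideal F f -> J f.
  move=> If; exists (fun=> 0); rewrite big1 ?subr0 // => l _; exact: mulr0.
pose t := [tuple x i | i < m].
have tE p : eval_at iota (tnth t) p = eval_at iota x p.
  by rewrite -!eval_at_map; apply: meval_eq => i; rewrite tnth_mktuple.
exists t => [f fF|l lt_l].
  by rewrite eval_at_map tE; apply/xJ/JI/in_ideal_gen.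
have : J (lf l).
  exists (fun l' => (l' == l)%:R); rewrite (bigD1 l) //= eqxx mulr1 big1 ?addr0.
    by rewrite subrr; apply: ideal0.
  by move=> l' /andP[_ /negbTE->]; rewrite mulr0.
move=> /xJ; rewrite /lf rmorphB /= /eval_at mmapC mmapX mmap1U tnth_mktuple.
by move/eqP; rewrite subr_eq0 => /eqP.
Qed.

(** All elements inserted into the basis vanish at a, so their span does not contain 1. *)
Lemma solution_alive (a : m.-tuple k) n : is_common_zero F a -> alive d B (take n a).
Proof.
move=> a0; rewrite /alive.
pose S (f : {mpoly k[m]}) := f.@[tnth a] = 0.
have linS : lin_closed S.
  split=> [|c f g]; rewrite /S ?meval0 // mevalD mevalZ => -> ->.
  by rewrite mulr0 addr0.
have := pivotP (degree_order m d) (reduce (specialize d B (take n a)) 1).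
case: (pivot _ _) => // none.
have : reduce (specialize d B (take n a)) 1 = 0.
  apply/mpolyP => mu; rewrite mcoeff0.
  have [//|nz] := eqVneq (reduce (specialize d B (take n a)) 1)@_mu 0.
  apply: none; rewrite mem_pivot_order.
  apply: (reduce_supported (echelon_specialize _) _) nz.
  by apply/supported_monomials; rewrite msize1.
move/(kernel_closed linS) => S1; suff : S 1 by rewrite /S meval1 => /eqP; rewrite oner_eq0.
apply: S1; apply: inserts_closed => // [p pB|f /mapP[[l nu]]].
  by apply: a0; apply: ideal_basis_sub pB.
case/allpairsP=> -[l' nu'] [/=]; rewrite mem_filter => /andP[lt_l _] _ [-> ->] ->.
rewrite /S /linear_form mevalM mevalB mevalC mevalXU /=.
have -> : nth 0 (take n a) l' = tnth a l'.
  rewrite nth_take; first by rewrite (tnth_nth 0).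
  by move: lt_l; rewrite size_take; case: (ltnP n (size a)) => // le_n /leq_trans; apply.
by rewrite subrr mul0r.
Qed.

(** If no pivot were a power of X_i, [reduce_small] would make the nonzero univariate element of I
    equal to zero. Its degree is at most e <= d, which is why B reduces it to 0. *)
Lemma eliminantP i : exists2 f, eliminant d B i = Some f &
  [/\ in_ideal F f, f != 0 & supported (predI (mem mons) (is_power i)) f].
Proof.
have sB f : f \in map snd B -> supported (mem mons) f.
  by move=> /mapP[p pB ->]; apply: (echelon_supported (echelon_ideal_basis d F)).
have echP : echelon mons (is_power i) (power_basis d B i).
  by apply: echelon_inserts => //; exact: echelon_nil.
have [f [If f0 sf]] := univariate_in_ideal all_s uF radF le_e i.
have kerf : reduce (power_basis d B i) f = 0.
  have kerB : reduce B f = 0.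
    apply: (ideal_basis_kernel lastF) => //; apply/msize_leP => mu /sf[j le_j ->].
    by rewrite mdegMn mdeg1 mul1n ltnS (leq_trans le_j).
  apply: kernel_closed (lin_closed_kernel _) _ kerB => p pB.
  by apply: inserts_kernel => //; [exact: echelon_nil|apply: map_f].
have /(reduce_small echP)[] : supported (is_power i) f.
  by move=> mu /sf[j _ ->]; rewrite /is_power mulmnE mnm1E eqxx mul1n.
rewrite kerf /eliminant => /esym; case filtE : [seq p <- _ | _] => [|p E] /=.
  by move=> f0'; rewrite f0' eqxx in f0.
have : p \in [seq p <- power_basis d B i | is_power i p.1] by rewrite filtE mem_head.
rewrite mem_filter => /andP[pow pP] _ _; exists p.2 => //; split.
- apply: (inserts_closed (lin_closed_ideal F) (E := [::])) pP => // f' /mapP[q qB ->].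
  exact: ideal_basis_sub qB.
- apply/eqP => p0; have := echelon_pivot1 echP pP.
  by rewrite p0 mcoeff0 => /esym/eqP; rewrite oner_eq0.
- move=> mu nz; rewrite /= (echelon_small echP pP pow nz) andbT.
  exact: (echelon_supported echP pP nz).
Qed.

Definition eliminant_poly (i : 'I_m) (f : {mpoly k[m]}) : {poly k} :=
  \poly_(j < d.+1) f@_(U_(i) *+ j).

Lemma eliminant_polyP i f : f != 0 -> supported (predI (mem mons) (is_power i)) f ->
  [/\ eliminant_poly i f != 0, (size (eliminant_poly i f) <= d.+1)%N,
      coefs (t := d) (eliminant_poly i f) = power_coefs i f &
      forall x : m.-tuple k, (eliminant_poly i f).[tnth x i] = f.@[tnth x]].
Proof.
move=> f0 sf; have [mu nz] : exists mu, f@_mu != 0.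
  apply: contrapT => no_mu; move/eqP: f0; apply; apply/mpolyP => mu; rewrite mcoeff0.
  by apply/eqP; apply: contraT => nz; case: no_mu; exists mu.
have powP nu : f@_nu != 0 -> exists2 j : 'I_d.+1, nu = (U_(i) *+ j)%MM & true.
  move=> /sf/andP[/=]; rewrite mem_monomials => nu_d /eqP nuE.
  have lt_j : (nu i < d.+1)%N.
    by rewrite ltnS (leq_trans _ nu_d) // mdegE (bigD1 i) //= leq_addr.
  by exists (Ordinal lt_j).
split.
- apply/eqP => /(congr1 (fun p : {poly k} => p`_(mu i))); rewrite coef_poly coef0.
  have [j jE _] := powP mu nz; move: nz; rewrite jE mulmnE mnm1E eqxx mul1n ltn_ord.
  by move=> /eqP.
- exact: size_poly.
- by apply/funext => j; rewrite /coefs coef_poly ltn_ord.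
- move=> x; have fE : f = \sum_(j < d.+1) f@_(U_(i) *+ j) *: 'X_[U_(i) *+ j].
    have Uinj : injective (fun j => U_(i) *+ j)%MM.
      move=> j j' /(congr1 (fun nu : 'X_{1..m} => nu i)).
      by rewrite !mulmnE mnm1E eqxx !mul1n.
    apply/mpolyP => nu; rewrite raddf_sum /=.
    have [nu0|/powP[j -> _]] := eqVneq f@_nu 0.
      rewrite nu0 big1 // => j _; rewrite mcoeffZ mcoeffX.
      by case: eqP => [->|_]; rewrite ?nu0 ?mul0r ?mulr0.
    rewrite (bigD1 j) //= big1 ?addr0 => [|j' j'j]; rewrite mcoeffZ mcoeffX (inj_eq Uinj).
      by rewrite eqxx mulr1.
    by rewrite -(inj_eq val_inj) in j'j; rewrite (negbTE j'j) mulr0.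
  rewrite horner_poly [in RHS]fE raddf_sum; apply: eq_bigr => j _ /=.
  rewrite mevalZ mevalX (bigD1 i) //= big1 ?mulr1 => [|l li]; rewrite mulmnE mnm1E.
    by rewrite eqxx mul1n.
  by rewrite eq_sym (negbTE li).
Qed.

Variable fac : ctree k 'I_d.+1.
Hypothesis facP : forall f : {poly k}, f != 0 -> (size f <= d.+1)%N ->
  is_factorization f (output (coefs f) fac).

Lemma candidates_size i : (size (candidates fac B i) <= d)%N.
Proof.
rewrite /candidates; have [f -> [_ f0 sf]] := eliminantP i.
have [p0 szp <- _] := eliminant_polyP f0 sf.
apply: leq_trans (size_roots _) _; rewrite -ltnS; apply: leq_trans szp.
by apply: factorization_size => //; apply: facP => //; apply: size_poly.
Qed.

Lemma candidates_uniq i : uniq (candidates fac B i).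
Proof. by rewrite /candidates; case: (eliminant _ _ _) => // f; apply: uniq_roots. Qed.

Lemma solution_candidate (a : m.-tuple k) i :
  is_common_zero F a -> tnth a i \in candidates fac B i.
Proof.
move=> a0; rewrite /candidates; have [f -> [If f0 sf]] := eliminantP i.
have [p0 szp <- evalp] := eliminant_polyP f0 sf.
apply: (factorization_roots (facP p0 szp)) => //.
by rewrite rootE evalp a0.
Qed.

Lemma alive_uniq_size (n : nat) (sols : seq (seq k)) : (n <= m)%N -> uniq sols ->
  (forall al, al \in sols -> size al = n /\ alive d B al) -> (size sols <= e)%N.
Proof.
move=> le_nm usols solsP.
pose Pr (al : seq k) (x : m.-tuple L) := is_zero iota F x /\
  forall l : 'I_m, (l < size al)%N -> tnth x l = iota (nth 0 al l).
suff [zs [zs_uniq zs_size zsP]] : exists zs : seq (m.-tuple L),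
    [/\ uniq zs, size zs = size sols &
      forall x, x \in zs -> exists2 al, al \in sols & Pr al x].
  rewrite -zs_size; apply: le_e => // x /zsP[al _ [x0 _]].
  exact: x0.
elim: sols usols solsP => [|al sols IH] /=; first by exists [::].
case/andP=> al_notin usols solsP.
have [||zs [zs_uniq zs_size zsP]] := IH => //.
  by move=> be be_in; apply: solsP; rewrite inE be_in orbT.
have [sz_al /alive_zero[x x0 xal]] := solsP al (mem_head _ _).
exists (x :: zs); rewrite /= zs_uniq zs_size andbT; split=> // [|y].
  apply/negP => /zsP[be be_in [_ xbe]].
  have [sz_be _] : size be = n /\ alive d B be by apply: solsP; rewrite inE be_in orbT.
  suff al_be : al = be by rewrite al_be be_in in al_notin.
  apply: (@eq_from_nth _ 0); first by rewrite sz_be.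
  move=> l lt_l; have lt_lm : (l < m)%N by rewrite (leq_trans lt_l) // sz_al.
  apply: (fmorph_inj iota).
  by rewrite -(xal (Ordinal lt_lm)) // xbe //= sz_be -sz_al.
rewrite inE => /predU1P[->|/zsP[be be_in Py]].
  by exists al; rewrite ?mem_head.
by exists be; rewrite // inE be_in orbT.
Qed.

Definition search_inv (rest : seq 'I_m) (sols : seq (seq k)) : Prop :=
  exists2 n, (n <= m)%N & [/\ rest = drop n (enum 'I_m), uniq sols,
    forall al, al \in sols -> size al = n /\ alive d B al &
    forall a : m.-tuple k, is_common_zero F a -> take n a \in sols].

Lemma search_inv_size rest sols : search_inv rest sols -> (size sols <= d)%N.
Proof.
by move=> [n le_n [_ us solsP _]]; apply: leq_trans (alive_uniq_size le_n us solsP) le_ed.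
Qed.

Lemma search_inv_start : search_inv (enum 'I_m) [seq al <- [:: [::]] | alive d B al].
Proof.
exists 0%N => //; rewrite drop0; split=> // [|al|a a0].
- exact: filter_uniq.
- by rewrite mem_filter inE andbC => /andP[/eqP-> live].
- by rewrite mem_filter inE take0 eqxx andbT -(take0 a); apply: solution_alive.
Qed.

Lemma search_inv_step i rest sols : search_inv (i :: rest) sols ->
  search_inv rest (extend_solutions fac B sols i).
Proof.
move=> [n le_n [restE us solsP complete]].
have lt_n : (n < m)%N.
  have := congr1 size restE; rewrite size_drop size_enum_ord /=.
  by case: ltngtP le_n => // ->; rewrite subnn.
have [iE rest'E] : i = n :> nat /\ rest = drop n.+1 (enum 'I_m).
  move: restE; rewrite (drop_nth i) ?size_enum_ord // => -[{1}-> ->].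
  by rewrite nth_enum_ord.
exists n.+1 => //; split=> // [|al|a a0].
- apply/filter_uniq/allpairs_uniq => //; first exact: candidates_uniq.
  by move=> [al a] [be b] _ _ /= /rcons_inj[-> ->].
- rewrite mem_filter => /andP[live /allpairsP[[be b] [/= /solsP[sz_be _] _ alE]]].
  by split=> //; rewrite alE size_rcons sz_be.
- rewrite mem_filter solution_alive //=; apply/allpairsP.
  exists (take n a, tnth a i); rewrite complete // solution_candidate //; split=> //=.
  by rewrite (take_nth 0) ?size_tuple // (tnth_nth 0) iE.
Qed.

Lemma foldl_inv (T S : Type) (Inv : seq T -> S -> Prop) (g : S -> T -> S) (t : seq T) (z : S) :
  (forall x r z, Inv (x :: r) z -> Inv r (g z x)) -> Inv t z -> Inv [::] (foldl g z t).
Proof. by move=> fall_step; elim: t z => //= x t IH z /fall_step/IH. Qed.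

(** For a tuple of full length, the zero given by [alive_zero] has all its coordinates prescribed,
    so it is the tuple itself; no equation of the system has to be checked at the end. *)
Lemma search_correct : is_solution_list F (search fac B).
Proof.
have [n le_n [restE us solsP complete]] : search_inv [::] (search fac B).
  exact: foldl_inv search_inv_step search_inv_start.
have nm : n = m.
  apply/eqP; rewrite eqn_leq le_n /= leqNgt; apply/negP => lt_n.
  by have := congr1 size restE; rewrite size_drop size_enum_ord /=; lia.
move=> al; split=> [al_in|[a -> a0]]; last first.
  by have := complete a a0; rewrite nm take_oversize // size_tuple.
have [sz_al live] := solsP al al_in.
have sz_al' : size al == m by rewrite sz_al nm.
exists (Tuple sz_al') => // f If.
have [x x0 xal] := alive_zero live.
have xE : tnth x =1 (fun i => iota (tnth (Tuple sz_al') i)).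
  by move=> i; rewrite xal ?(tnth_nth 0) // sz_al nm.
apply/eqP; rewrite -(fmorph_eq0 iota) -(is_zero_ideal x0 If) -eval_at_map.
apply/eqP; rewrite eval_at_map /eval_at /meval /mmap rmorph_sum; apply: eq_bigr => mu _.
by rewrite rmorphM rmorph_prod; congr (_ * _); apply: eq_bigr => i _; rewrite xE rmorphXn.
Qed.

End SearchCorrect.

(** * Programs for computation trees *)

Fixpoint all2P (A B : Type) (R : A -> B -> Prop) (s : seq A) (t : seq B) : Prop :=
  match s, t with
  | [::], [::] => True
  | a :: s', b :: t' => R a b /\ all2P R s' t'
  | _, _ => False
  end.

Section All2P.
Variables (A B : Type) (R : A -> B -> Prop).

Lemma all2P_size s t : all2P R s t -> size s = size t.
Proof. by elim: s t => [|a s IH] [|b t] //= [_ /IH->]. Qed.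

Lemma all2P_sub (R' : A -> B -> Prop) s t : (forall a b, R a b -> R' a b) ->
  all2P R s t -> all2P R' s t.
Proof. by move=> sub; elim: s t => [|a s IH] [|b t] //= [/sub ? /IH]. Qed.

Lemma all2P_cat s s' t t' : all2P R s t -> all2P R s' t' -> all2P R (s ++ s') (t ++ t').
Proof. by elim: s t => [|a s IH] [|b t] //= [Rab /IH{}IH /IH]. Qed.

Lemma all2P_rcons s t a b : all2P R s t -> R a b -> all2P R (rcons s a) (rcons t b).
Proof. by move=> st ab; rewrite -!cats1; apply: all2P_cat. Qed.

Lemma all2P_nth a0 b0 s t i : all2P R s t -> R a0 b0 -> R (nth a0 s i) (nth b0 t i).
Proof. by elim: s t i => [|a s IH] [|b t] [|i] //= [Rab /IH{}IH /IH]. Qed.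

Lemma all2P_map (T : eqType) (f : T -> A) (g : T -> B) (s : seq T) :
  (forall x, x \in s -> R (f x) (g x)) -> all2P R (map f s) (map g s).
Proof.
elim: s => //= x s IH Rs; split; first by apply: Rs; rewrite mem_head.
by apply: IH => y ys; apply: Rs; rewrite inE ys orbT.
Qed.

Lemma all2P_map2 A' B' (R' : A' -> B' -> Prop) (f : A -> A') (g : B -> B') s t :
  (forall a b, R a b -> R' (f a) (g b)) -> all2P R s t -> all2P R' (map f s) (map g t).
Proof. by move=> sub; elim: s t => [|a s IH] [|b t] //= [/sub ? /IH]. Qed.

Lemma all2P_filter (p : pred A) (q : pred B) s t : (forall a b, R a b -> p a = q b) ->
  all2P R s t -> all2P R (filter p s) (filter q t).
Proof.
move=> pq; elim: s t => [|a s IH] [|b t] //= [Rab /IH st].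
by rewrite (pq _ _ Rab); case: (q b).
Qed.

Lemma all2P_allpairs A1 B1 (R1 : A1 -> B1 -> Prop) A2 B2 (R2 : A2 -> B2 -> Prop)
    (f : A1 -> A2 -> A) (g : B1 -> B2 -> B) s1 t1 s2 t2 :
  (forall a1 a2 b1 b2, R1 a1 b1 -> R2 a2 b2 -> R (f a1 a2) (g b1 b2)) ->
  all2P R1 s1 t1 -> all2P R2 s2 t2 ->
  all2P R [seq f a1 a2 | a1 <- s1, a2 <- s2] [seq g b1 b2 | b1 <- t1, b2 <- t2].
Proof.
move=> fg + st2; elim: s1 t1 => [|a1 s1 IH] [|b1 t1] //= [Rab1 /IH st1].
apply: all2P_cat => //; elim: s2 t2 st2 {IH st1} => [|a2 s2 IH] [|b2 t2] //= [Rab2 /IH].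
by split=> //; apply: fg.
Qed.

End All2P.

Lemma all2P_eq (T : Type) (s : seq T) : all2P eq s s.
Proof. by elim: s. Qed.

Section Programs.
Variables (k : fieldType) (X : Type) (inp : X -> k).
Local Notation addr := (addr k X).

(* Programs in continuation-passing style: a program receives the number of
   registers in use, and its continuation the updated number and the result. *)
Definition prog (A : Type) := nat -> (nat -> A -> ctree k X) -> ctree k X.

Definition ret A (a : A) : prog A := fun n K => K n a.
Definition bind A B (c : prog A) (f : A -> prog B) : prog B :=
  fun n K => c n (fun n' a => f a n' K).
Definition op (o : fop) (a b : addr) : prog addr := fun n K => Op o a b (K n.+1 (Reg n)).
Definition test (a : addr) : prog bool := fun n K => IfZero a (K n true) (K n false).

Definition extends (regs regs' : seq k) : Prop := exists more, regs' = regs ++ more.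

Lemma extends_refl regs : extends regs regs.
Proof. by exists [::]; rewrite cats0. Qed.

Lemma extends_trans regs1 regs2 regs3 :
  extends regs1 regs2 -> extends regs2 regs3 -> extends regs1 regs3.
Proof. by move=> [m1 ->] [m2 ->]; exists (m1 ++ m2); rewrite catA. Qed.

(** An address beyond the last register reads 0 now and possibly another value later. Validity is
    what makes [den] stable when registers are appended. *)
Definition valid (n : nat) (a : addr) : Prop := if a is Reg j then (j < n)%N else True.

Definition den (regs : seq k) (a : addr) (x : k) : Prop :=
  valid (size regs) a /\ fetch inp regs a = x.

Definition stable A B (R : seq k -> A -> B -> Prop) : Prop :=
  forall regs regs' a b, extends regs regs' -> R regs a b -> R regs' a b.

Lemma den_stable : stable den.
Proof.
move=> regs _ a x [more ->] [va <-]; case: a va => //= j lt_j.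
by split; rewrite /= ?nth_cat ?lt_j // size_cat ltn_addr.
Qed.

Definition seq_rel A B (R : seq k -> A -> B -> Prop) regs : seq A -> seq B -> Prop :=
  all2P (R regs).

Lemma seq_rel_stable A B (R : seq k -> A -> B -> Prop) : stable R -> stable (seq_rel R).
Proof. by move=> stR regs regs' s t ext; apply: all2P_sub => a b; apply: stR. Qed.

Definition eq_rel A (regs : seq k) (a b : A) : Prop := a = b.

(** A Hoare triple with cost. Registers, result and cost are chosen before the continuation K, as
    the path through c depends on the registers only; b is a mere upper bound, so costs can be
    weakened. *)
Definition runs A (c : prog A) regs (b : nat) (post : seq k -> A -> Prop) : Prop :=
  exists regs' a cst, [/\ extends regs regs', (cst <= b)%N, post regs' a &
    forall K, run_from inp regs (c (size regs) K) =
      ((run_from inp regs' (K (size regs') a)).1,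
       (cst + (run_from inp regs' (K (size regs') a)).2)%N)].

Lemma runs_ret A (a : A) regs b (post : seq k -> A -> Prop) :
  post regs a -> runs (ret a) regs b post.
Proof.
move=> pa; exists regs, a, 0%N; split=> //; first exact: extends_refl.
by move=> K; rewrite /ret add0n -surjective_pairing.
Qed.

Lemma runs_bind A B (c : prog A) (f : A -> prog B) regs b1 b2 P Q :
  runs c regs b1 P ->
  (forall regs' a, extends regs regs' -> P regs' a -> runs (f a) regs' b2 Q) ->
  runs (bind c f) regs (b1 + b2) Q.
Proof.
move=> [r1 [a1 [c1 [ext1 le1 P1 run1]]]] /(_ r1 a1 ext1 P1).
move=> [r2 [a2 [c2 [ext2 le2 P2 run2]]]].
exists r2, a2, (c1 + c2)%N; split=> //; [exact: extends_trans ext1 ext2|exact: leq_add|].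
by move=> K; rewrite /bind run1 run2 addnA.
Qed.

Lemma runs_weaken A (c : prog A) regs b b' (P Q : seq k -> A -> Prop) :
  (b <= b')%N -> (forall regs' a, extends regs regs' -> P regs' a -> Q regs' a) ->
  runs c regs b P -> runs c regs b' Q.
Proof.
move=> le_b PQ [r [a [c1 [ext le_c Pa run]]]]; exists r, a, c1; split=> //.
  exact: leq_trans le_b.
exact: PQ.
Qed.

Lemma runs_op o a b x y regs : den regs a x -> den regs b y ->
  runs (op o a b) regs 1 (fun r c => den r c (apply_fop o x y)).
Proof.
move=> [_ ax] [_ by_]; exists (rcons regs (apply_fop o x y)), (Reg (size regs)), 1%N.
split=> //; first by exists [:: apply_fop o x y]; rewrite cats1.
  by split; rewrite /= ?size_rcons // nth_rcons ltnn eqxx.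
by move=> K; rewrite /op /= ax by_ size_rcons.
Qed.

Lemma runs_test a x regs : den regs a x ->
  runs (test a) regs 1 (fun r c => c = (x == 0)).
Proof.
move=> [_ ax]; exists regs, (x == 0), 1%N; split=> //; first exact: extends_refl.
by move=> K; rewrite /test /= ax; case: (x == 0).
Qed.

Fixpoint mapM A T (f : T -> prog A) (s : seq T) : prog (seq A) :=
  if s is x :: s' then bind (f x) (fun a => bind (mapM f s') (fun l => ret (a :: l)))
  else ret [::].

Lemma runs_mapM A B (R : seq k -> A -> B -> Prop) (T : eqType) (f : T -> prog A)
    (g : T -> B) s regs b : stable R ->
  (forall regs' x, extends regs regs' -> x \in s ->
     runs (f x) regs' b (fun r a => R r a (g x))) ->
  runs (mapM f s) regs (size s * b) (fun r l => seq_rel R r l (map g s)).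
Proof.
move=> stR; elim: s regs => [|x s IH] regs fP /=; first exact: runs_ret.
rewrite mulSn; apply: runs_bind; first by apply: fP; [exact: extends_refl|exact: mem_head].
move=> r1 a ext1 Ra; rewrite -[(_ * b)%N]addn0; apply: runs_bind.
  apply: IH => r2 y ext2 ys; apply: fP; first exact: extends_trans ext1 ext2.
  by rewrite inE ys orbT.
by move=> r2 l ext2 Rl; apply: runs_ret; split=> //; apply: stR Ra.
Qed.

Fixpoint foldM A S (f : S -> A -> prog S) (z : S) (s : seq A) : prog S :=
  if s is a :: s' then bind (f z a) (fun z' => foldM f z' s') else ret z.

(** The invariant relates the pure state to the elements still to come, so that the cost of a step
    may rely on bounds for the state. *)
Lemma runs_foldM A A' S S' (RA : seq k -> A -> A' -> Prop) (RS : seq k -> S -> S' -> Prop)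
    (Inv : seq A' -> S' -> Prop) (f : S -> A -> prog S) (g : S' -> A' -> S')
    s s' z z' regs b :
  stable RA -> stable RS -> seq_rel RA regs s s' -> RS regs z z' -> Inv s' z' ->
  (forall a r w, Inv (a :: r) w -> Inv r (g w a)) ->
  (forall regs' a a' r w w', extends regs regs' -> RA regs' a a' -> RS regs' w w' ->
     Inv (a' :: r) w' -> runs (f w a) regs' b (fun r w1 => RS r w1 (g w' a'))) ->
  runs (foldM f z s) regs (size s' * b) (fun r w => RS r w (foldl g z' s')).
Proof.
move=> stA stS + + + InvS; elim: s s' z z' regs => [|a s IH] [|a' s'] // z z' regs.
  by move=> _ Rz _ _; apply: runs_ret.
move=> [Ra Rs] Rz Iz fP /=; rewrite mulSn; apply: runs_bind.
  exact: (fP regs _ _ s' _ _ (extends_refl regs) Ra Rz Iz).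
move=> r1 w ext1 Rw; apply: IH => //.
- exact: (seq_rel_stable stA ext1 Rs).
- exact: InvS.
- by move=> r2 b1 b1' r w1 w1' ext2; apply: fP; apply: extends_trans ext1 ext2.
Qed.

Fixpoint iterateM S (f : S -> prog S) (n : nat) (z : S) : prog S :=
  if n is n'.+1 then bind (iterateM f n' z) f else ret z.

Lemma runs_iterateM S S' (RS : seq k -> S -> S' -> Prop) (Inv : S' -> Prop)
    (f : S -> prog S) (g : S' -> S') n z z' regs b :
  stable RS -> RS regs z z' -> Inv z' -> (forall w, Inv w -> Inv (g w)) ->
  (forall regs' w w', extends regs regs' -> RS regs' w w' -> Inv w' ->
     runs (f w) regs' b (fun r w1 => RS r w1 (g w'))) ->
  runs (iterateM f n z) regs (n * b) (fun r w => RS r w (iter n g z')).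
Proof.
move=> stS Rz Iz InvS fP; elim: n => [|n IH] /=; first exact: runs_ret.
rewrite mulSnr; apply: runs_bind IH _ => r1 w ext1 Rw; apply: fP => //.
by elim: (n) => //= n' ?; apply: InvS.
Qed.

Fixpoint filterM A (p : A -> prog bool) (s : seq A) : prog (seq A) :=
  if s is a :: s' then
    bind (p a) (fun b => bind (filterM p s') (fun l => ret (if b then a :: l else l)))
  else ret [::].

Lemma runs_filterM A A' (RA : seq k -> A -> A' -> Prop) (p : A -> prog bool) (q : pred A')
    s s' regs b : stable RA -> seq_rel RA regs s s' ->
  (forall regs' a a', extends regs regs' -> RA regs' a a' ->
     runs (p a) regs' b (fun r c => c = q a')) ->
  runs (filterM p s) regs (size s' * b) (fun r l => seq_rel RA r l (filter q s')).
Proof.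
move=> stA; elim: s s' regs => [|a s IH] [|a' s'] // regs Rs pP; first exact: runs_ret.
case: Rs => Ra Rs; rewrite [filterM _ _]/= [size _]/= mulSn.
apply: runs_bind (pP _ _ _ (extends_refl regs) Ra) _ => r1 c ext1 cE.
rewrite -[(_ * b)%N]addn0; apply: runs_bind.
  apply: (IH s' r1); first exact: (seq_rel_stable stA ext1 Rs).
  by move=> r2 a1 a1' ext2; apply: pP; apply: extends_trans ext1 ext2.
move=> r2 l ext2 Rl; apply: runs_ret; rewrite /= -cE; case: c {cE} => //.
by split=> //; apply: stA (extends_trans ext1 ext2) Ra.
Qed.

(* Running a foreign tree whose inputs are addresses; an out-of-range register
   of the foreign tree reads 0. *)
Section Embed.
Variables (Y : Type) (sigma : Y -> addr) (base : nat).

Definition embed_addr (n : nat) (a : Defs.addr k Y) : addr :=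
  match a with
  | Inp y => sigma y
  | Cst c => Cst c
  | Reg j => if (base + j < n)%N then Reg (base + j) else Cst 0
  end.

Fixpoint embed_from (t : ctree k Y) : prog (seq (seq addr)) := fun n K =>
  match t with
  | Out y => K n (map (map (embed_addr n)) y)
  | Op o a b t' => Op o (embed_addr n a) (embed_addr n b) (embed_from t' n.+1 K)
  | IfZero a t0 t1 => IfZero (embed_addr n a) (embed_from t0 n K) (embed_from t1 n K)
  end.

End Embed.

Definition embed Y (sigma : Y -> addr) (t : ctree k Y) : prog (seq (seq addr)) :=
  fun n => embed_from sigma n t n.

Lemma runs_embed Y (sigma : Y -> addr) (inp' : Y -> k) (t : ctree k Y) regs :
  (forall y, den regs (sigma y) (inp' y)) ->
  runs (embed sigma t) regs (cost inp' t)
    (fun r out => seq_rel (seq_rel den) r out (output inp' t)).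
Proof.
move=> sigmaP; rewrite /cost /output /embed.
have embedP iregs a : den (regs ++ iregs)
    (embed_addr sigma (size regs) (size (regs ++ iregs)) a) (fetch inp' iregs a).
  case: a => [y|c|j] //=; first by apply: den_stable (sigmaP y); exists iregs.
  rewrite size_cat ltn_add2l; case: ltnP => [lt_j|le_j]; last by rewrite nth_default.
  by split; rewrite /= ?size_cat ?ltn_add2l // nth_cat ltnNge leq_addr /= addKn.
(* The foreign registers sit right after [regs], and the induction has to start from any stage of
   the foreign run. *)
suff H iregs : runs (fun n => embed_from sigma (size regs) t n) (regs ++ iregs)
    (run_from inp' iregs t).2
    (fun r out => seq_rel (seq_rel den) r out (run_from inp' iregs t).1).
  by have := H [::]; rewrite cats0.
elim: t iregs => [ys|o a b t IH|a t0 IH0 t1 IH1] iregs /=.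
- apply: (runs_ret (a := map (map (embed_addr sigma (size regs) (size (regs ++ iregs)))) ys)).
  elim: ys => //= y ys IHys; split=> //; elim: y => //= a y IHy; split=> //.
- have [_ aE] := embedP iregs a; have [_ bE] := embedP iregs b.
  have [r [out [c [ext le_c outP run]]]] :=
    IH (rcons iregs (apply_fop o (fetch inp' iregs a) (fetch inp' iregs b))).
  exists r, out, c.+1; split=> //.
    apply: extends_trans ext; rewrite -cats1 catA.
    by exists [:: apply_fop o (fetch inp' iregs a) (fetch inp' iregs b)].
  move=> K; rewrite /= aE bE; have := run K.
  by rewrite -rcons_cat size_rcons => ->.
- have [_ aE] := embedP iregs a.
  case: ifP => a0; [have [r [out [c [ext le_c outP run]]]] := IH0 iregs
                   |have [r [out [c [ext le_c outP run]]]] := IH1 iregs];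
  by exists r, out, c.+1; split=> // K; rewrite /= aE a0 run.
Qed.

End Programs.

(** * Linear algebra programs *)

Section LinearAlgebra.
Variables (k : fieldType) (X : Type) (inp : X -> k) (m : nat).
Variables (mons : seq 'X_{1..m}) (small : pred 'X_{1..m}).

Local Notation addr := (addr k X).
(** Addresses of coefficients. Moving coefficients around, as in multiplication by a variable, costs
    no operation. *)
Definition vec : Type := 'X_{1..m} -> addr.
Definition vec_basis : Type := seq ('X_{1..m} * vec).

Let N := size mons.

Definition vec_rel (regs : seq k) (v : vec) (f : {mpoly k[m]}) : Prop :=
  forall mu, mu \in mons -> den inp regs (v mu) f@_mu.

Definition elt_rel (regs : seq k) (p : 'X_{1..m} * vec) (q : 'X_{1..m} * {mpoly k[m]}) : Prop :=
  [/\ p.1 = q.1, q.1 \in mons & vec_rel regs p.2 q.2].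

Definition basis_rel := seq_rel elt_rel.

Lemma vec_rel_stable : stable vec_rel.
Proof. by move=> r r' v f ext vf mu mu_in; apply: den_stable ext (vf mu mu_in). Qed.

Lemma elt_rel_stable : stable elt_rel.
Proof. by move=> r r' p q ext [pq q_in pv]; split=> //; apply: vec_rel_stable ext pv. Qed.

Lemma basis_rel_stable : stable basis_rel.
Proof. exact/seq_rel_stable/elt_rel_stable. Qed.

Definition tabulate (f : 'X_{1..m} -> prog k X addr) : prog k X vec :=
  bind (mapM f mons) (fun l => ret (fun mu => nth (Cst 0) l (index mu mons))).

Lemma runs_tabulate f (g : {mpoly k[m]}) regs b :
  (forall regs' mu, extends regs regs' -> mu \in mons ->
     runs inp (f mu) regs' b (fun r a => den inp r a g@_mu)) ->
  runs inp (tabulate f) regs (N * b) (fun r v => vec_rel r v g).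
Proof.
move=> fP; rewrite -[(N * b)%N]addn0; apply: runs_bind.
  exact: (runs_mapM (R := den inp) (g := fun mu => g@_mu) (@den_stable _ _ inp) fP).
move=> r l ext Rl; apply: runs_ret => mu mu_in /=.
have -> : g@_mu = nth 0 [seq g@_mu | mu <- mons] (index mu mons).
  by rewrite (nth_map mu) ?index_mem // nth_index.
by apply: all2P_nth Rl _; split.
Qed.

Definition reduceM (E : vec_basis) (v : vec) : prog k X vec :=
  foldM (fun v p => tabulate (fun mu =>
    bind (op Mul (v p.1) (p.2 mu)) (fun t => op Defs.Sub (v mu) t))) v E.

Lemma runs_reduce E E' v f regs :
  basis_rel regs E E' -> vec_rel regs v f ->
  runs inp (reduceM E v) regs (size E' * (N * 2)) (fun r w => vec_rel r w (reduce E' f)).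
Proof.
move=> RE Rv; apply: (runs_foldM (RA := elt_rel) (RS := vec_rel) (Inv := fun _ _ => True)) => //.
- exact: elt_rel_stable.
- exact: vec_rel_stable.
move=> r1 [mu b] [mu' b'] rest w g ext [/= -> mu_in Rb] Rw _.
apply: runs_tabulate => r2 nu ext2 nu_in; rewrite mcoeffB mcoeffZ.
apply: (runs_bind (b1 := 1) (b2 := 1)).
  apply: runs_op; apply: den_stable ext2 _; [exact: Rw|exact: Rb].
move=> r3 t ext3 dt; apply: (runs_op Defs.Sub) => //.
by apply: den_stable (extends_trans ext2 ext3) _; apply: Rw.
Qed.

Fixpoint pivotM (ord : seq 'X_{1..m}) (v : vec) : prog k X (option 'X_{1..m}) :=
  if ord is mu :: ord' then
    bind (test (v mu)) (fun z => if z then pivotM ord' v else ret (Some mu))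
  else ret None.

Lemma runs_pivot ord v f regs : {subset ord <= mons} -> vec_rel regs v f ->
  runs inp (pivotM ord v) regs (size ord) (fun r o => o = pivot ord f).
Proof.
move=> + Rv; elim: ord regs Rv => [|mu ord IH] regs Rv sub; first exact: runs_ret.
rewrite /= -add1n; apply: runs_bind.
  by apply: runs_test; apply: Rv; apply: sub; rewrite mem_head.
move=> r z ext ->; case: ifP => _; last exact: runs_ret.
apply: IH; first exact: vec_rel_stable ext Rv.
by move=> nu nu_in; apply: sub; rewrite inE nu_in orbT.
Qed.

Definition insertM (ord : seq 'X_{1..m}) (E : vec_basis) (v : vec) : prog k X vec_basis :=
  bind (reduceM E v) (fun r => bind (pivotM ord r) (fun o =>
    if o is Some mu then
      bind (tabulate (fun nu => op Div (r nu) (r mu))) (fun w => ret (rcons E (mu, w)))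
    else ret E)).

Let ord := pivot_order mons small.

Let ord_sub : {subset ord <= mons}.
Proof. by move=> mu; rewrite mem_pivot_order. Qed.

Lemma runs_insert E E' v f regs :
  basis_rel regs E E' -> vec_rel regs v f -> echelon mons small E' ->
  runs inp (insertM ord E v) regs (4 * N ^ 2) (fun r F => basis_rel r F (insert ord E' f)).
Proof.
move=> RE Rv echE.
(* At most N reductions of 2N operations each, then N tests for the pivot and N divisions. *)
have cost_le : (size E' * (N * 2) + (N + (N * 1 + 0)) <= 4 * N ^ 2)%N.
  have := echelon_size echE; rewrite -/N => le_E.
  have : (size E' * (N * 2) <= N * (N * 2))%N by rewrite leq_mul2r le_E orbT.
  have : (N <= N * N)%N by case: (N) => // n; rewrite leq_pmulr.
  by rewrite expnS expn1; lia.
apply: (runs_weaken cost_le (fun _ _ _ H => H)).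
apply: (runs_bind (runs_reduce RE Rv)) => r1 w ext1 Rw; apply: runs_bind.
  by rewrite -[N in X in runs _ _ _ X](size_pivot_order mons small); apply: runs_pivot Rw.
move=> r2 o ext2 ->; rewrite /insert; have := pivotP ord (reduce E' f).
case: (pivot _ _) => [mu [mu_in rmu]|_]; last first.
  by apply: runs_ret; apply: basis_rel_stable (extends_trans ext1 ext2) RE.
apply: runs_bind.
  apply: (runs_tabulate (g := ((reduce E' f)@_mu)^-1 *: reduce E' f)) => r3 nu ext3 nu_in.
  rewrite mcoeffZ mulrC; have ext23 := extends_trans ext2 ext3.
  by apply: (runs_op Div); apply: den_stable ext23 _; apply: Rw => //; apply: ord_sub.
move=> r3 u ext3 Ru; apply: runs_ret; apply: all2P_rcons.
  by apply: basis_rel_stable (extends_trans ext1 (extends_trans ext2 ext3)) RE.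
by split=> //=; apply: ord_sub.
Qed.

Definition insertsM (ord : seq 'X_{1..m}) (E : vec_basis) (vs : seq vec) : prog k X vec_basis :=
  foldM (insertM ord) E vs.

Lemma runs_inserts E E' vs fs regs :
  basis_rel regs E E' -> seq_rel vec_rel regs vs fs -> echelon mons small E' ->
  (forall f, f \in fs -> supported (mem mons) f) ->
  runs inp (insertsM ord E vs) regs (size fs * (4 * N ^ 2))
    (fun r F => basis_rel r F (inserts ord E' fs)).
Proof.
move=> RE Rv echE sfs.
pose Inv (rest : seq {mpoly k[m]}) (E0 : seq ('X_{1..m} * {mpoly k[m]})) :=
  echelon mons small E0 /\
  forall f, f \in rest -> supported (mem mons) f.
apply: (runs_foldM (RA := vec_rel) (RS := basis_rel) (Inv := Inv)) => //.
- exact: vec_rel_stable.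
- exact: basis_rel_stable.
- move=> f rest E1 [echE1 srest]; split.
    by apply: echelon_insert => //; apply: srest; rewrite mem_head.
  by move=> g g_in; apply: srest; rewrite inE g_in orbT.
- by move=> r1 w g rest E1 E1' ext Rw RE1 [echE1 _]; apply: runs_insert.
Qed.

End LinearAlgebra.

(** * The solver *)

Section SolverProgram.
Variables (k : fieldType) (X : Type) (inp : X -> k) (m d : nat).

Local Notation addr := (addr k X).
Local Notation vec := (vec k X m).
Local Notation vec_basis := (vec_basis k X m).
Let mons := monomials m d.
Let N := size mons.
Let dord := degree_order m d.

Local Notation vec_rel := (vec_rel inp mons).
Local Notation basis_rel := (basis_rel inp mons).

Definition shift (v : vec) (i : 'I_m) : vec :=
  fun mu => if mu i == 0%N then Cst 0 else v (mu - U_(i))%MM.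

Lemma mcoeff_mulX (f : {mpoly k[m]}) i mu :
  (f * 'X_i)@_mu = if mu i == 0%N then 0 else f@_(mu - U_(i)).
Proof.
case: eqP => [mu0|/eqP mui].
  apply/eqP; rewrite mcoeff_eq0 (perm_mem (msuppMX _ _)); apply/mapP => -[nu _ muE].
  by move: mu0; rewrite muE mnmDE mnm1E eqxx.
have le_mu : (U_(i) <= mu)%MM by rewrite lep1mP.
by rewrite -{1}(submK le_mu) addmC mcoeffMX.
Qed.

Lemma shift_rel regs v f i : vec_rel regs v f -> vec_rel regs (shift v i) (f * 'X_i).
Proof.
move=> Rv mu; rewrite mem_monomials => mu_d; rewrite mcoeff_mulX /shift.
case: ifP => _; first by split.
by apply: Rv; rewrite mem_monomials (leq_trans (mdegB _ _)).
Qed.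

Definition productsM (E : vec_basis) : seq vec :=
  [seq shift p.2 i | p <- [seq p <- E | (mdeg p.1 < d)%N], i <- enum 'I_m].

Definition stepM (E : vec_basis) : prog k X vec_basis := insertsM mons dord E (productsM E).

Definition closureM (E : vec_basis) : prog k X vec_basis := iterateM stepM N E.

Lemma runs_step E E' regs : basis_rel regs E E' -> echelon mons (@low_degree m d) E' ->
  runs inp (stepM E) regs (N * m * (4 * N ^ 2)) (fun r F => basis_rel r F (fall_step d E')).
Proof.
move=> RE echE.
have le_cost : (size (products d E') * (4 * N ^ 2) <= N * m * (4 * N ^ 2))%N.
  rewrite leq_mul2r size_allpairs size_enum_ord leq_mul2r.
  by rewrite size_filter (leq_trans (count_size _ _) (echelon_size echE)) !orbT.
apply: (runs_weaken le_cost (fun _ _ _ H => H)).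
apply: runs_inserts => //; last by move=> f; apply: products_supported.
apply: (all2P_allpairs (R1 := elt_rel inp mons regs) (R2 := eq)).
- by move=> p i q j [_ _ Rpq] <-; apply: shift_rel.
- by apply: all2P_filter RE => p q [-> _ _].
- exact: all2P_eq.
Qed.

Lemma runs_closure E E' regs : basis_rel regs E E' -> echelon mons (@low_degree m d) E' ->
  runs inp (closureM E) regs (N * (N * m * (4 * N ^ 2)))
    (fun r F => basis_rel r F (fall_closure d E')).
Proof.
move=> RE echE; apply: (runs_iterateM (Inv := echelon mons (@low_degree m d))) => //.
- exact: basis_rel_stable.
- by move=> E1; apply: echelon_step.
- by move=> r1 E1 E1' _; apply: runs_step.
Qed.

(** The coefficients are written down directly, so forming the product takes no operation. *)
Definition linear_vec (al : seq addr) (x : 'I_m * 'X_{1..m}) : vec :=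
  fun mu => if mu == (x.2 + U_(x.1))%MM then Cst (-1)
            else if mu == x.2 then nth (Cst 0) al x.1 else Cst 0.

Lemma den_cst regs c : den inp regs (Cst c) c. Proof. by split. Qed.

Lemma linear_vec_rel regs al al' x : seq_rel (den inp) regs al al' ->
  vec_rel regs (linear_vec al x) (linear_form al' x).
Proof.
move=> Ral mu _; case: x => l nu; rewrite /linear_vec /linear_form /=.
rewrite mulrBl mcoeffB mcoeffCM mcoeffX -mpolyXD mcoeffX.
rewrite [(U_(l) + nu)%MM]addmC ![_ == mu]eq_sym.
case: eqP => [->|_] /=.
  have -> : ((nu + U_(l))%MM == nu) = false.
    apply/eqP => /(congr1 (@mdeg m)); rewrite mdegD mdeg1; lia.
  by rewrite mulr0 sub0r; apply: den_cst.
rewrite subr0; case: eqP => _; last by rewrite mulr0; apply: den_cst.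
by rewrite mulr1; apply: all2P_nth Ral _; apply: den_cst.
Qed.

Definition specializeM (E : vec_basis) (al : seq addr) : prog k X vec_basis :=
  insertsM mons dord E (map (linear_vec al) (linear_index m d (size al))).

Definition one_vec : vec := fun mu => if mu == 0%MM then Cst 1 else Cst 0.

Lemma one_vec_rel regs : vec_rel regs one_vec 1.
Proof.
by move=> mu _; rewrite mcoeff1 /one_vec; case: eqP => _; apply: den_cst.
Qed.

Definition aliveM (E : vec_basis) (al : seq addr) : prog k X bool :=
  bind (specializeM E al) (fun E' => bind (reduceM mons E' one_vec) (fun r =>
    bind (pivotM dord r) (fun o => ret (isSome o)))).

Definition alive_cost : nat :=
  m * size (monomials m d.-1) * (4 * N ^ 2) + (N * (N * 2) + (N + 0)).

Variable F : seq {mpoly k[m]}.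
Hypothesis d_gt0 : (0 < d)%N.
Let B := ideal_basis d F.

Lemma runs_alive E al al' regs : basis_rel regs E B -> seq_rel (den inp) regs al al' ->
  runs inp (aliveM E al) regs alive_cost (fun _ c => c = alive d B al').
Proof.
move=> RE Ral; have size_al : size al = size al' := all2P_size Ral.
have echS := echelon_specialize F d_gt0 al'.
have le_cost : (size (map (linear_form al') (linear_index m d (size al'))) * (4 * N ^ 2) <=
    m * size (monomials m d.-1) * (4 * N ^ 2))%N.
  rewrite leq_mul2r size_map size_allpairs leq_mul2r size_filter.
  by rewrite (leq_trans (count_size _ _)) ?size_enum_ord ?orbT.
apply: runs_bind.
  apply: (runs_weaken le_cost (fun _ _ _ H => H)).
  apply: runs_inserts RE _ (echelon_ideal_basis d F) _.
    by rewrite size_al; apply: all2P_map => x _; apply: linear_vec_rel.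
  by move=> f /mapP[x x_in ->]; apply: linear_form_supported.
move=> r1 E1 ext1 RE1; apply: runs_bind.
  have le_cost2 : (size (specialize d B al') * (N * 2) <= N * (N * 2))%N.
    by rewrite leq_mul2r (echelon_size echS) orbT.
  apply: (runs_weaken le_cost2 (fun _ _ _ H => H)).
  exact: runs_reduce RE1 (one_vec_rel r1).
move=> r2 w ext2 Rw; apply: runs_bind.
  rewrite /N -(size_pivot_order mons (@low_degree m d)); apply: runs_pivot Rw.
  by move=> mu; rewrite mem_pivot_order.
by move=> r3 o ext3 ->; apply: runs_ret.
Qed.

Definition power_basisM (E : vec_basis) (i : 'I_m) : prog k X vec_basis :=
  insertsM mons (pivot_order mons (is_power i)) [::] (map snd E).

Fixpoint memM (a : addr) (acc : seq addr) : prog k X bool :=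
  if acc is c :: acc' then
    bind (op Defs.Sub a c) (fun t => bind (test t) (fun z => if z then ret true else memM a acc'))
  else ret false.

Lemma runs_mem a x acc acc' regs : den inp regs a x -> seq_rel (den inp) regs acc acc' ->
  runs inp (memM a acc) regs (size acc' * 2) (fun _ b => b = (x \in acc')).
Proof.
elim: acc acc' regs => [|c acc IH] [|c' acc'] // regs da; first by move=> _; apply: runs_ret.
case=> dc Racc; rewrite [size _]/= mulSn -[2%N]/(1 + 1)%N -addnA.
apply: runs_bind; first exact: runs_op da dc.
move=> r1 t ext1 dt; apply: runs_bind; first exact: runs_test dt.
move=> r2 z ext2 ->; rewrite /= subr_eq0 inE; case: eqP => _; first exact: runs_ret.
have ext := extends_trans ext1 ext2.
by apply: IH; [apply: den_stable ext da|apply: (seq_rel_stable (@den_stable _ _ inp) ext Racc)].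
Qed.

Definition add_rootM (acc : seq addr) (p : seq addr) : prog k X (seq addr) :=
  bind (test (nth (Cst 0) p 1)) (fun z => if z then ret acc else
  bind (op Div (nth (Cst 0) p 0) (nth (Cst 0) p 1)) (fun q =>
  bind (op Defs.Sub (Cst 0) q) (fun a =>
  bind (memM a acc) (fun b => ret (if b then acc else a :: acc))))).

Lemma runs_add_root acc acc' p p' regs : (size acc' <= d)%N ->
  seq_rel (den inp) regs acc acc' -> seq_rel (den inp) regs p p' ->
  runs inp (add_rootM acc p) regs (3 + 2 * d) (fun r w => seq_rel (den inp) r w (add_root acc' p')).
Proof.
move=> le_acc Racc Rp.
have dp j : den inp regs (nth (Cst 0) p j) (nth 0 p' j).
  by apply: all2P_nth Rp _; apply: den_cst.
have stD := @den_stable _ _ inp; have stS := seq_rel_stable stD.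
(* One test, one division, one subtraction, and two operations for each comparison with a known
   root. *)
have le_cost : (1 + (1 + (1 + (size acc' * 2 + 0))) <= 3 + 2 * d)%N by lia.
apply: (runs_weaken le_cost (fun _ _ _ H => H)).
apply: runs_bind; first exact: runs_test (dp 1%N).
move=> r1 z ext1 ->; rewrite /add_root; case: ifP => _.
  by apply: runs_ret; apply: stS ext1 Racc.
apply: runs_bind; first by apply: (runs_op Div); apply: stD ext1 (dp _).
move=> r2 q ext2 dq; apply: runs_bind; first exact: (runs_op Defs.Sub (den_cst r2 0) dq).
move=> r3 a ext3 da; have ext := extends_trans ext1 (extends_trans ext2 ext3).
apply: runs_bind; first exact: runs_mem da (stS _ _ _ _ ext Racc).
move=> r4 b ext4 ->; apply: runs_ret; rewrite /=.
case: ifP => _; first exact: (stS _ _ _ _ (extends_trans ext ext4) Racc).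
split; first exact: stD ext4 da.
exact: (stS _ _ _ _ (extends_trans ext ext4) Racc).
Qed.

Definition rootsM (out : seq (seq addr)) : prog k X (seq addr) := foldM add_rootM [::] out.

Lemma runs_roots out out' regs : (size out' <= d)%N ->
  seq_rel (seq_rel (den inp)) regs out out' ->
  runs inp (rootsM out) regs (d * (3 + 2 * d)) (fun r w => seq_rel (den inp) r w (linear_roots out')).
Proof.
move=> le_out Rout; have stD := @den_stable _ _ inp; have stS := seq_rel_stable stD.
apply: (runs_weaken (leq_mul le_out (leqnn _)) (fun _ _ _ H => H)).
pose Inv (rest : seq (seq k)) (acc : seq k) := (size acc + size rest <= d)%N.
apply: (runs_foldM (RA := seq_rel (den inp)) (RS := seq_rel (den inp)) (Inv := Inv)) => //.
- move=> p rest acc; rewrite /Inv /= => le_acc; apply: leq_trans le_acc.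
  by rewrite addnS -addSn leq_add2r /add_root; case: ifP => _ //; case: ifP.
- move=> r1 p p' rest acc acc' ext Rp Racc; rewrite /Inv => le_acc.
  by apply: runs_add_root => //; apply: leq_trans le_acc; apply: leq_addr.
Qed.

Variable fac : ctree k 'I_d.+1.

Definition eliminantM (PE : vec_basis) (i : 'I_m) : option vec :=
  ohead [seq p.2 | p <- PE & is_power i p.1].

Definition candidatesM (E : vec_basis) (i : 'I_m) : prog k X (seq addr) :=
  bind (power_basisM E i) (fun PE =>
    if eliminantM PE i is Some v then
      bind (embed (fun j : 'I_d.+1 => v (U_(i) *+ j)%MM) fac) rootsM
    else ret [::]).

Variable K : nat.
Hypothesis facK : forall f : {poly k}, f != 0 -> (size f <= d.+1)%N ->
  is_factorization f (output (coefs f) fac) /\ (cost (coefs f : 'I_d.+1 -> k) fac <= K)%N.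
Hypothesis eliminantP : forall i, exists2 f, eliminant d B i = Some f &
  [/\ in_ideal F f, f != 0 & supported (predI (mem mons) (is_power i)) f].

Definition candidates_cost : nat := N * (4 * N ^ 2) + (K + d * (3 + 2 * d)).

Lemma runs_candidates E i regs : basis_rel regs E B ->
  runs inp (candidatesM E i) regs candidates_cost
    (fun r C => seq_rel (den inp) r C (candidates fac B i)).
Proof.
move=> RE; apply: runs_bind.
  have le_cost : (size (map snd B) * (4 * N ^ 2) <= N * (4 * N ^ 2))%N.
    by rewrite leq_mul2r size_map (echelon_size (echelon_ideal_basis d F)) orbT.
  apply: (runs_weaken le_cost (fun _ _ _ H => H)).
  apply: (runs_inserts (E' := [::]) (fs := map snd B)); first by [].
  - by apply: all2P_map2 RE => p q [].
  - exact: echelon_nil.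
  - move=> f /mapP[p pB ->]; exact: (echelon_supported (echelon_ideal_basis d F) pB).
move=> r1 PE ext1 RP.
have [f fE [If f0 sf]] := eliminantP i; rewrite /candidates fE.
(* Related bases have equal pivots, so the program selects the vector of the same element. *)
have [v vE Rv] : exists2 v, eliminantM PE i = Some v & vec_rel r1 v f.
  have /(all2P_map2 (R' := vec_rel r1) (f := snd) (g := snd)) :
      all2P (elt_rel inp mons r1) [seq p <- PE | is_power i p.1]
        [seq p <- power_basis d B i | is_power i p.1].
    by apply: all2P_filter RP => p q [-> _ _].
  move=> /(_ (fun p q pq => let: And3 _ _ H := pq in H)).
  move: fE; rewrite /eliminant /eliminantM.
  case: [seq p.2 | p <- power_basis d B i & _] => // g gs [->].
  by case: [seq p.2 | p <- PE & _] => // v vs [Rv _]; exists v.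
rewrite vE; have [p0 szp coefE _] := eliminant_polyP f0 sf.
have [facf le_K] := facK p0 szp; rewrite coefE in facf le_K.
apply: runs_bind.
  apply: (runs_weaken le_K (fun _ _ _ H => H)); apply: runs_embed => j.
  by apply: Rv; rewrite mem_monomials mdegMn mdeg1 mul1n -ltnS.
move=> r2 out ext2 Rout; apply: runs_roots => //.
by rewrite -ltnS (leq_trans (factorization_size facf p0)).
Qed.

Definition extendM (E : vec_basis) (sols : seq (seq addr)) (i : 'I_m) : prog k X (seq (seq addr)) :=
  bind (candidatesM E i) (fun C => filterM (aliveM E) [seq rcons al a | al <- sols, a <- C]).

Definition searchM (E : vec_basis) : prog k X (seq (seq addr)) :=
  bind (filterM (aliveM E) [:: [::]]) (fun s0 => foldM (extendM E) s0 (enum 'I_m)).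

(** One test of the empty tuple; then, per variable, the candidates and the tests of at most d * d
    extensions. *)
Definition search_cost : nat := 1 * alive_cost + m * (candidates_cost + d * d * alive_cost).

Variable Inv : seq 'I_m -> seq (seq k) -> Prop.
Hypothesis Inv_start : Inv (enum 'I_m) [seq al <- [:: [::]] | alive d B al].
Hypothesis Inv_step : forall i rest sols, Inv (i :: rest) sols ->
  Inv rest (extend_solutions fac B sols i).
Hypothesis Inv_size : forall rest sols, Inv rest sols -> (size sols <= d)%N.
Hypothesis candidates_size : forall i, (size (candidates fac B i) <= d)%N.

Lemma runs_search E regs : basis_rel regs E B ->
  runs inp (searchM E) regs search_cost
    (fun r sols => seq_rel (seq_rel (den inp)) r sols (search fac B)).
Proof.
move=> RE; have stD := @den_stable _ _ inp; have stS := seq_rel_stable stD.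
apply: runs_bind.
  apply: (runs_filterM (q := alive d B) (s' := [:: [::]]) stS) => // r1 al al' ext Ral.
  by apply: runs_alive => //; apply: basis_rel_stable ext RE.
move=> r1 s0 ext1 Rs0; rewrite -[m in X in runs _ _ _ X](size_enum_ord m).
apply: (runs_foldM (RA := @eq_rel k 'I_m) (RS := seq_rel (seq_rel (den inp)))
  (g := extend_solutions fac B) (Inv := Inv)) => //.
- exact: seq_rel_stable.
- exact: all2P_eq.
move=> r2 i' i rest sols sols' ext2 -> Rsols Isols.
have RE2 := basis_rel_stable (extends_trans ext1 ext2) RE.
apply: (runs_bind (runs_candidates i RE2)) => r3 C ext3 RC.
have le_cost : (size [seq rcons al a | al <- sols', a <- candidates fac B i] * alive_cost <=
    d * d * alive_cost)%N.
  by rewrite leq_mul2r size_allpairs leq_mul ?orbT // (Inv_size Isols).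
apply: (runs_weaken le_cost (fun _ _ _ H => H)); apply: (runs_filterM (q := alive d B) stS).
  apply: all2P_allpairs (seq_rel_stable stS ext3 Rsols) RC => al a al' a' Ral Ra.
  exact: all2P_rcons.
move=> r4 al al' ext4 Ral; apply: runs_alive => //.
exact: basis_rel_stable (extends_trans ext3 ext4) RE2.
Qed.

End SolverProgram.

(** * The initial basis and the total cost *)

Definition generator_vecs (k : fieldType) (m d : nat) (degs : seq nat) :
    seq (vec k (nat * 'X_{1..m})%type m) :=
  [seq (fun mu => Inp (j, mu)) | j <- iota 0 (size degs) & (nth 0 degs j <= d)%N].

Definition ideal_basisM (k : fieldType) (m d : nat) (degs : seq nat) :
    prog k (nat * 'X_{1..m})%type (vec_basis k (nat * 'X_{1..m})%type m) :=
  bind (insertsM (monomials m d) (degree_order m d) [::] (generator_vecs k m d degs))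
    (closureM d).

Lemma runs_ideal_basis (k : fieldType) (m d : nat) (F : seq {mpoly k[m]}) regs :
  let N := size (monomials m d) in
  runs (system_coefs F) (ideal_basisM (k := k) (m := m) d (map (@tdeg k m) F)) regs
    (size F * (4 * N ^ 2) + N * (N * m * (4 * N ^ 2)))
    (fun r E => basis_rel (system_coefs F) (monomials m d) r E (ideal_basis d F)).
Proof.
move=> N; apply: runs_bind.
  have le_cost : (size (generators d F) * (4 * N ^ 2) <= size F * (4 * N ^ 2))%N.
    rewrite leq_mul2r size_map size_filter.
    by rewrite (leq_trans (count_size _ _)) ?size_iota ?orbT.
  apply: (runs_weaken le_cost (fun _ _ _ H => H)).
  apply: (runs_inserts (E' := [::]) (fs := generators d F));
    [by []| |exact: echelon_nil|exact: generators_supported].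
  rewrite /generator_vecs size_map (eq_in_filter (a2 := fun j => (tdeg (nth 0%R F j) <= d)%N)).
    by apply: all2P_map => j _ mu _; split.
  by move=> j; rewrite mem_iota => /andP[_ lt_j]; rewrite (nth_map 0).
move=> r E ext RE; apply: runs_closure => //.
by apply: echelon_inserts; [exact: echelon_nil|exact: generators_supported].
Qed.

Fixpoint depth (k X : Type) (t : ctree k X) : nat :=
  match t with
  | Out _ => 0
  | Op _ _ _ t' => (depth t').+1
  | IfZero _ t0 t1 => (maxn (depth t0) (depth t1)).+1
  end.

Lemma cost_depth (k : fieldType) X (inp : X -> k) t : (cost inp t <= depth t)%N.
Proof.
rewrite /cost; elim: t [::] => [//|o a b t IH|a t0 IH0 t1 IH1] regs /=.
  exact: IH.
by rewrite ltnS leq_max; case: ifP => _; rewrite ?IH0 ?IH1 ?orbT.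
Qed.

(** The bound x need not be an integer. The costs are bounded by the depth of the tree, so their
    maximum K is attained; it satisfies K <= x and allows all counting to be done in natural
    numbers. *)
Lemma worst_factorization_cost (k : fieldType) (R : numDomainType) (d : nat)
    (fac : ctree k 'I_d.+1) (x : R) :
  (forall f : {poly k}, f != 0 -> (size f <= d.+1)%N -> (cost (coefs f) fac)%:R <= x) ->
  exists2 K : nat, K%:R <= x &
    forall f : {poly k}, f != 0 -> (size f <= d.+1)%N -> (cost (coefs f) fac <= K)%N.
Proof.
move=> facx.
pose attained n := `[<exists f : {poly k}, [/\ f != 0, (size f <= d.+1)%N &
  cost (coefs f : 'I_d.+1 -> k) fac = n]>].
have ex_n : exists n, attained n.
  exists (cost (coefs (1 : {poly k}) : 'I_d.+1 -> k) fac); apply/asboolP; exists 1.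
  by rewrite oner_neq0 size_poly1.
have bounded n : attained n -> (n <= depth fac)%N.
  by move=> /asboolP[f [_ _ <-]]; apply: cost_depth.
case: (ex_maxnP ex_n bounded) => K /asboolP[f [f0 szf <-]] maxK.
exists (cost (coefs f) fac); first exact: facx.
by move=> h h0 szh; apply: maxK; apply/asboolP; exists h.
Qed.

(** For d = 0 one has e = 0 and there is no solution. The case is separate because a linear form
    does not fit into degree 0. *)
Definition solver_tree (k : fieldType) (fac : forall t : nat, ctree k 'I_t.+1) :
    system_solver k := fun m degs d =>
  if d == 0%N then Out [::] else
  bind (ideal_basisM d degs) (searchM (fac d)) 0 (fun _ sols => Out sols).

(** A is at most (4 + 2 + 1) M^4 and C at most (4 + 3 + 2) M^3 + K. The dominant term is m * d * d *
    A <= 7 M^7, and 27 = 4 + 7 + 9 + 7 collects the closure, the first test, the candidates and the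
    tests of extensions. *)
Lemma solver_cost_bound (n m d K N N1 M A C : nat) : (0 < M)%N -> (N <= M)%N -> (N1 <= M)%N ->
  (m <= M)%N -> (d <= M)%N ->
  A = (m * N1 * (4 * N ^ 2) + (N * (N * 2) + (N + 0)))%N ->
  C = (N * (4 * N ^ 2) + (K + d * (3 + 2 * d)))%N ->
  (n * (4 * N ^ 2) + N * (N * m * (4 * N ^ 2)) + (1 * A + m * (C + d * d * A))
    <= 27 * M ^ 7 * (1 + n) * (1 + K))%N.
Proof.
move=> M0 NM N1M mM dM AE CE.
have powM i j : (i <= j)%N -> (M ^ i <= M ^ j)%N by move=> ?; rewrite leq_pexp2l.
have N2 : (N ^ 2 <= M ^ 2)%N by rewrite leq_exp2r.
have leA : (A <= 7 * M ^ 4)%N.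
  have h1 : (m * N1 * (4 * N ^ 2) <= M * M * (4 * M ^ 2))%N by rewrite !leq_mul.
  have h2 : (N * (N * 2) <= M * (M * 2))%N by rewrite !leq_mul.
  have := powM 2 4 isT; have := powM 1 4 isT; rewrite AE; lia.
have leC : (C <= 9 * M ^ 3 + K)%N.
  have h1 : (N * (4 * N ^ 2) <= M * (4 * M ^ 2))%N by rewrite !leq_mul.
  have h2 : (d * (3 + 2 * d) <= M * (3 + 2 * M))%N by rewrite leq_mul ?leq_add ?leq_mul.
  have := powM 2 3 isT; have := powM 1 3 isT; rewrite CE; lia.
have h1 : (n * (4 * N ^ 2) <= n * (4 * M ^ 7))%N.
  by rewrite leq_mul2l leq_mul2l (leq_trans N2 (powM 2 7 isT)) !orbT.
have h2 : (N * (N * m * (4 * N ^ 2)) <= M * (M * M * (4 * M ^ 2)))%N by rewrite !leq_mul.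
have h3 : (m * (C + d * d * A) <= M * (9 * M ^ 3 + K + M * M * (7 * M ^ 4)))%N.
  by rewrite leq_mul ?leq_add ?leq_mul.
have hK : (M * K <= M ^ 7 * K)%N by rewrite leq_mul2r (powM 1 7) ?orbT.
have := powM 4 7 isT; have := powM 5 7 isT; nia.
Qed.

Theorem proposition2p8 (R : realFieldType) (P : {poly R}) :
  exists Q : {mpoly R[3]},
  forall (k : fieldType) (kbar : closedFieldType)
         (iota : {rmorphism k -> kbar}) (g : nat -> R),
    is_algebraic_closure iota ->
    can_factor_within k (fun t => P.[g t]) ->
    exists solver : system_solver k,
    forall (m : nat) (F : seq {mpoly k[m]}) (e dF : nat),
      uniq F ->
      radical_ideal F ->
      at_most_solutions iota F e ->
      is_last_fall_degree F (Some dF) ->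
      let d := maxn dF e in
      let T := solver m (map (@tdeg k m) F) d in
      is_solution_list F (output (system_coefs F) T) /\
      (cost (system_coefs F) T)%:R
        <= Q.@[tnth [tuple (size F)%:R; g d; ((m + d) ^ d)%N%:R]].
Proof.
pose i0 : 'I_3 := inord 0; pose i1 : 'I_3 := inord 1; pose i2 : 'I_3 := inord 2.
pose PX : {mpoly R[3]} := (map_poly (@mpolyC 3 R) P).['X_i1].
(* The bound of [solver_cost_bound] with M = (m + d)^d, n the number of polynomials, and K replaced
   by its upper bound P(g d). *)
exists (27%:R * 'X_i2 ^+ 7 * (1 + 'X_i0) * (1 + PX)) => k kbar iota g _ factorable.
have [s all_s] := factorizable_field_finite factorable.
case: factorable => fac facP; exists (solver_tree fac) => m F e dF uF radF le_e lastF d T.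
set v := tnth _.
have QE : (27%:R * 'X_i2 ^+ 7 * (1 + 'X_i0) * (1 + PX)).@[v] =
    27%:R * ((m + d) ^ d)%N%:R ^+ 7 * (1 + (size F)%:R) * (1 + P.[g d]).
  have PXE : PX.@[v] = P.[g d].
    rewrite /PX -horner_map /= -map_poly_comp /= mevalXU /v (tnth_nth 0) inordK //=.
    by congr (_.[_]); rewrite map_poly_id // => c _ /=; rewrite mevalC.
  rewrite 3!rmorphM rmorph_nat rmorphXn /= !mevalD !meval1 PXE !mevalXU.
  by rewrite /v !(tnth_nth 0) !inordK.
have facd (f : {poly k}) : f != 0 -> (size f <= d.+1)%N ->
    is_factorization f (output (coefs f) (fac d)) /\ (cost (coefs f) (fac d))%:R <= P.[g d].
  exact: facP.
have facP' (f : {poly k}) : f != 0 -> (size f <= d.+1)%N ->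
    is_factorization f (output (coefs f) (fac d)) by move=> f0 /(facd f f0)[].
have [K le_K costK] := worst_factorization_cost (fun f f0 szf => (facd f f0 szf).2).
rewrite QE; have le_dF : (dF <= d)%N by apply: leq_maxl.
have le_ed : (e <= d)%N by apply: leq_maxr.
suff [sol le_T] : is_solution_list F (output (system_coefs F) T) /\
    (cost (system_coefs F) T <= 27 * ((m + d) ^ d) ^ 7 * (1 + size F) * (1 + K))%N.
  split=> //.
  apply: (@Order.POrderTheory.le_trans _ _ (27 * ((m + d) ^ d) ^ 7 * (1 + size F) * (1 + K))%N%:R).
    by rewrite ler_nat.
  rewrite !natrM natrX !natrD; apply: ler_wpM2l; last by rewrite lerD2l.
  by rewrite !mulr_ge0 ?exprn_ge0 ?addr_ge0 ?ler0n ?ler01.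
rewrite /T /solver_tree; case: posnP => [d0|d_gt0].
  (* Here e = 0, while a solution over k would be a zero over the closure. *)
  split=> // al; split=> // -[a alE a0].
  have := le_e [:: [tuple iota (tnth a i) | i < m]] isT; rewrite leqNgt ltnS.
  move: le_ed; rewrite d0 leqn0 => /eqP-> /(_ _)/negP/=; case=> // x.
  rewrite inE => /eqP-> f fF.
  rewrite eval_at_map /eval_at.
  have := congr1 iota (a0 f (in_ideal_gen uF fF)); rewrite rmorph0 => <-.
  rewrite /meval /mmap rmorph_sum; apply: eq_bigr => mu _.
  rewrite rmorphM rmorph_prod; congr (_ * _); apply: eq_bigr => i _.
  by rewrite tnth_mktuple rmorphXn.
have [regs [sols [c [ext le_c Rsols run]]]] : runs (system_coefs F)
    (bind (ideal_basisM (k := k) (m := m) d (map (@tdeg k m) F)) (searchM (fac d))) [::]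
    (size F * (4 * size (monomials m d) ^ 2) +
      size (monomials m d) * (size (monomials m d) * m * (4 * size (monomials m d) ^ 2)) +
      search_cost m d K)
    (fun r sols => seq_rel (seq_rel (den (system_coefs F))) r sols
       (search (fac d) (ideal_basis d F))).
  apply: runs_bind; first exact: runs_ideal_basis.
  move=> r E ext RE.
  apply: (@runs_search _ _ (system_coefs F) m d F d_gt0 (fac d) K _ _
    (search_inv F d) _ _ _ _ E r RE).
  - by move=> f f0 szf; have [fact _] := facd f f0 szf; split; last exact: costK.
  - exact: (eliminantP all_s uF radF le_e lastF le_dF le_ed).
  - exact: search_inv_start.
  - exact: (search_inv_step all_s uF radF le_e lastF le_dF le_ed d_gt0 facP').
  - exact: (search_inv_size all_s uF radF le_e lastF le_dF le_ed d_gt0).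
  - exact: (candidates_size all_s uF radF le_e lastF le_dF le_ed facP').
have md_le : (m + d <= (m + d) ^ d)%N by rewrite -{1}[(m + d)%N]expn1 leq_pexp2l ?addn_gt0 ?d_gt0 ?orbT.
have m_le : (m.+1 ^ d <= (m + d) ^ d)%N.
  by rewrite leq_exp2r // -addn1 leq_add2l.
have outE := run (fun _ sols => Out sols); rewrite /= in outE.
have seqE (A B : Type) (r : A -> B -> Prop) (f : A -> B) s1 s2 :
    (forall a b, r a b -> f a = b) -> all2P r s1 s2 -> map f s1 = s2.
  by move=> rf; elim: s1 s2 => [|a' s1 IH] [|b' s2] //= [/rf-> /IH->].
split.
  rewrite /output outE /= (seqE _ _ _ _ _ _ _ Rsols); last first.
    by move=> al al'; apply: seqE => a b [].
  exact: (search_correct all_s uF radF le_e lastF le_dF le_ed d_gt0 facP').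
rewrite /cost outE /= addn0; apply: leq_trans le_c _.
apply: solver_cost_bound; [| | | | |reflexivity|reflexivity].
- by rewrite expn_gt0 addn_gt0 d_gt0 orbT.
- exact: leq_trans (size_monomials m d) m_le.
- apply: leq_trans (size_monomials m d.-1) _; apply: leq_trans m_le.
  by rewrite leq_pexp2l // leq_pred.
- exact: leq_trans (leq_addr d m) md_le.
- exact: leq_trans (leq_addl m d) md_le.
Qed.
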